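(* Consider $\mathcal{G}_{12q-4,12q}$, where $q\ge1$ is an integer. \begin{enumerate} \item[(a)] For sufficiently large $p$ (i.e. for all $p\in(0,1)$ sufficiently close to $1$), there is a unique $p$-optimal graph in $\mathcal{G}_{12q-4,12q}$, namely the perfectly balanced subdivision $G$ of the Wagner graph $W$ (each edge of $W$ is replaced by a path with $q$ edges). \item[(b)] For $q\ge8$, there is an imbalanced subdivision of $W$ in $\mathcal{G}_{12q-4,12q}$ with more spanning trees than $G$, which is therefore strictly more reliable than $G$ for all sufficiently small $p>0$. Hence (for $q\ge 8$) there is no uniquely optimal graph in $\mathcal{G}_{12q-4,12q}$. \end{enumerate}
   Context: Graphs are finite connected multigraphs (multiple edges and loops allowed), considered up to isomorphism. $\mathcal{G}_{n,m}$ is the set of connected graphs with $n$ vertices and $m$ edges. For $p\in(0,1)$, $R(G,p)$ is the probability that $G$ remains connected (on all its vertices) when each edge is independently retained with probability $p$ and deleted otherwise. For $G,H\in\mathcal{G}_{n,m}$, $H$ is strictly more reliable than $G$ with respect to $p$ if $R(H,p)>R(G,p)$. A graph in $\mathcal{G}_{n,m}$ is $p$-optimal if it maximizes $R(\cdot,p)$ over $\mathcal{G}_{n,m}$; it is uniquely optimal if for all $p\in(0,1)$ it is strictly more reliable with respect to $p$ than every other graph in $\mathcal{G}_{n,m}$. The Wagner graph $W$ is the 4-Möbius ladder: the 8-cycle together with the four edges joining opposite vertices of the cycle. A subdivision of $W$ is obtained by replacing each edge of $W$ by a path with at least one edge (a chain); its length is its number of edges. The subdivision is balanced if all chain lengths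 differ pairwise by at most one, and imbalanced otherwise. *)

(* Defs.v *)
From mathcomp Require Import all_boot all_order all_algebra.
From mathcomp Require Import boolp reals.

Set Implicit Arguments.
Unset Strict Implicit.
Unset Printing Implicit Defensive.

Import Order.TTheory GRing.Theory Num.Theory.

Local Open Scope ring_scope.

(* Undirected multigraphs, loops allowed.  The orientation given by src and    *)
(* tgt is only an encoding: every notion below except the construction         *)
(* subdivide, where reversing an edge gives an isomorphic result, depends only *)
(* on the unordered set of ends.                                               *)
Record mgraph := MGraph {
  vert : finType;
  edge : finType;
  src : edge -> vert;
  tgt : edge -> vert
}.

Definition ends (G : mgraph) (e : edge G) : {set vert G} := [set src e; tgt e].

Definition joins (G : mgraph) (e : edge G) (x y : vert G) : bool :=
  ends e == [set x; y].

Definition isomorphic (G H : mgraph) : Prop :=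
  exists (f : vert G -> vert H) (g : edge G -> edge H),
    [/\ bijective f, bijective g & forall e, ends (g e) = f @: ends e].

Section EdgeSubsets.
Variable G : mgraph.
Implicit Type A : {set edge G}.

Definition adj A : rel (vert G) := fun x y => [exists e in A, joins e x y].

(* The spanning subgraph (vert G, A) is connected. *)
Definition spanning_connected A : bool :=
  (0 < #|vert G|)%N && [forall x, forall y, connect (adj A) x y].

(* A cycle x_0 e_0 x_1 e_1 ... x_(k-1) e_(k-1) x_0, k >= 1, is given as the    *)
(* sequence of the pairs (x_i, e_i).  A loop is a cycle with k = 1 and a pair  *)
(* of parallel edges is one with k = 2.                                        *)
Definition graph_cycle A (c : seq (vert G * edge G)) : bool :=
  [&& c != [::], uniq (map fst c), uniq (map snd c),
      all (fun xe => xe.2 \in A) c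
    & cycle (fun xe yf => joins xe.2 xe.1 yf.1) c].

Definition acyclic A : Prop := forall c, ~~ graph_cycle A c.

Definition spanning_tree A : bool := spanning_connected A && `[< acyclic A >].

Definition nb_spanning_trees : nat := #|[set A | spanning_tree A]|.

Definition reliability (R : realType) (p : R) : R :=
  \sum_(A : {set edge G} | spanning_connected A)
     p ^+ #|A| * (1 - p) ^+ (#|edge G| - #|A|).

End EdgeSubsets.

Definition connected (G : mgraph) : bool := spanning_connected [set: edge G].

Definition graph_class (n m : nat) (G : mgraph) : Prop :=
  [/\ connected G, #|vert G| = n & #|edge G| = m].

Definition strictly_more_reliable (R : realType) (p : R) (H G : mgraph) : Prop :=
  reliability G p < reliability H p.

Definition p_optimal (R : realType) (n m : nat) (p : R) (G : mgraph) : Prop :=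
  graph_class n m G /\
  forall H, graph_class n m H -> reliability H p <= reliability G p.

Definition uniquely_optimal (R : realType) (n m : nat) (G : mgraph) : Prop :=
  graph_class n m G /\
  forall p : R, 0 < p < 1 ->
  forall H, graph_class n m H -> ~ isomorphic H G ->
    strictly_more_reliable p G H.

Section Subdivision.
Variables (G : mgraph) (l : edge G -> nat).

Definition subdiv_vert : finType := (vert G + {e : edge G & 'I_(l e).-1})%type.

Definition subdiv_edge : finType := {e : edge G & 'I_(l e)}.

(* The k-th vertex, 0 <= k <= l e, of the chain replacing e: src e for k = 0,  *)
(* tgt e for k = l e, and an inner vertex otherwise.                           *)
Definition chain_vert (e : edge G) (k : nat) : subdiv_vert :=
  if k is k'.+1 then
    if insub k' is Some j then inr (@Tagged _ e (fun e => 'I_(l e).-1) j)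
    else inl (tgt e)
  else inl (src e).

Definition subdivide : mgraph :=
  @MGraph subdiv_vert subdiv_edge
    (fun a => chain_vert (tag a) (tagged a))
    (fun a => chain_vert (tag a) (tagged a).+1).

Definition balanced : Prop := forall e f, (l e <= (l f).+1)%N.

End Subdivision.

Definition imbalanced_subdivision (G H : mgraph) : Prop :=
  exists l : edge G -> nat,
    [/\ forall e, (0 < l e)%N, ~ balanced l & isomorphic H (subdivide l)].

(* The cycle on 2k vertices together with the k edges joining opposite ones.   *)
Definition mobius_ladder (k : nat) : mgraph :=
  @MGraph 'I_(k + k) ('I_(k + k) + 'I_k)%type
    (fun e => match e with inl i => i | inr j => lshift k j end)
    (fun e => match e with inl i => ordS i | inr j => rshift k j end).

Definition wagner : mgraph := mobius_ladder 4.

Definition balanced_wagner (q : nat) : mgraph :=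
  subdivide (fun _ : edge wagner => q).

(* Main.v *)
(* Let c_j(H) be the number of j-sets of edges whose deletion leaves H         *)
(* connected, so that R(H, p) = sum_j c_j(H) p^(m-j) (1-p)^j.  For p near 1    *)
(* reliability compares (c_0, c_1, ...) lexicographically, for p near 0 it     *)
(* compares c_5, the number of spanning trees.  Suppressing vertices of degree *)
(* 2 writes H as a subdivision of a graph K with chain lengths l, and c_j(H)   *)
(* is then the sum over the connected deletions X of K, |X| = j, of the        *)
(* product of the l e, e in X.  If H is bridgeless (c_1 maximal), K has at     *)
(* most 12 edges, hence c_2(H) <= e_2(l) <= 66 q^2, with equality only if all  *)
(* chains have length q and K is cubic, simple and 3-edge-connected on 8       *)
(* vertices.  An enumeration of the cubic graphs on 8 vertices shows that c_3  *)
(* and then c_4 single out the Wagner graph.  For (b), lengthening one spoke   *)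
(* and shortening an adjacent rim edge by one gives                            *)
(* c_5 = 392 q^5 + 7 q^4 - 51 q^3, against 392 q^5 for the balanced one.       *)

Require Import Defs.
From mathcomp Require Import all_boot all_order all_algebra.
From mathcomp Require Import boolp reals.
From mathcomp Require Import ring lra zify.

Import Order.TTheory GRing.Theory Num.Theory.

Set Implicit Arguments.
Unset Strict Implicit.
Unset Printing Implicit Defensive.

(** * Connectivity and spanning trees *)

(** Reliability is a sum of the counts [nb_deletions H j] against p^(m-j) (1-p)^j ([reliabilityE]).
    The counts add up to at most 2^m, so for 1 - p < 4^-(m+1) the first index where two graphs
    differ decides ([bernstein_lt_near1]), and for p < 4^-(m+1) the last one does
    ([bernstein_lt_near0]). Both thresholds depend on m alone, hence hold against all competitors at
    once. With 12q - 4 vertices and 12q edges the counts vanish beyond j = 5, and the one at 5 is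
    the number of spanning trees ([nb_spanning_treesE]). What remains is to compare integers.

    A deletion that leaves a subdivision connected takes at most one edge from each chain, so the
    counts are sums of products of chain lengths over the connected deletions of the underlying
    graph ([nb_deletions_subdivide]).

    Near 1, any competitor H is a subdivision of a graph K without suppressible vertices
    ([reduced_decomposition]). If c_1(H) attains its maximum 12q, there is no bridge, K has at least
    three edges at each vertex, and |E| - |V| = 4 leaves at most 12 edges ([reduced_few_edges]).
    Then c_2(H) is at most the second elementary symmetric function of at most 12 lengths of sum
    12q, hence at most 66 q^2; equality forces equal lengths and a K that no two edges disconnect,
    which is therefore cubic and simple on 8 vertices ([nb_deletions2_extremal]). A finite
    enumeration shows that such a K is the Wagner graph or falls behind it in c_3 or, with c_3
    equal, in c_4 ([cubic_classification]).

    Near 0, a spoke of W lies in more complements of spanning trees than a rim edge, so moving one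
    unit of length from a rim edge to a spoke gains 7 q^4 trees to leading order, at a cost of 51
    q^3 ([imbalanced_more_deletions]). A uniquely optimal graph would have to be the balanced
    subdivision by its behaviour near 1, and that one is beaten near 0. *)

Section Connectivity.
Variable G : mgraph.
Implicit Types (A B : {set edge G}) (x y : vert G) (e : edge G).

Lemma joins_ends e : joins e (src e) (tgt e).
Proof. exact: eqxx. Qed.

Lemma joins_srctgtP e x y :
  reflect ((x = src e /\ y = tgt e) \/ (x = tgt e /\ y = src e)) (joins e x y).
Proof.
apply: (iffP eqP) => [E|[[-> ->]|[-> ->]]]; last 2 first.
- by [].
- by rewrite /ends setUC.
have: x \in ends e by rewrite E !inE eqxx.
have: y \in ends e by rewrite E !inE eqxx orbT.
have: src e \in [set x; y] by rewrite -E !inE eqxx.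
have: tgt e \in [set x; y] by rewrite -E !inE eqxx orbT.
rewrite !inE => /orP[]/eqP-> /orP[]/eqP->; rewrite ?orbb.
- by move=> /eqP-> _; left.
- by right.
- by left.
- by move=> _ /eqP->; left.
Qed.

Lemma adj_sym A : symmetric (adj A).
Proof. by move=> x y; apply: eq_existsb => e; rewrite /joins setUC. Qed.

Lemma connect_adjC A : connect_sym (adj A).
Proof. exact/sym_connect_sym/adj_sym. Qed.

Lemma adj_edge A e : e \in A -> adj A (src e) (tgt e).
Proof. by move=> eA; apply/existsP; exists e; rewrite eA joins_ends. Qed.

Lemma adjP A x y : reflect (exists2 e, e \in A & joins e x y) (adj A x y).
Proof. exact: exists_inP. Qed.

Lemma connect_adjS A B x y :
  A \subset B -> connect (adj A) x y -> connect (adj B) x y.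
Proof.
move=> sAB; apply: connect_sub => u v /adjP[e eA J]; apply: connect1.
by apply/adjP; exists e => //; apply: (subsetP sAB).
Qed.

(** Replaces induction along paths: to bound what is reachable, it suffices to exhibit a vertex set
    that no edge of [A] leaves. *)
Lemma connect_closedW A (U : {pred vert G}) x y :
  (forall e, e \in A -> (src e \in U) = (tgt e \in U)) ->
  connect (adj A) x y -> (x \in U) = (y \in U).
Proof.
move=> clU; apply: closed_connect => u v /adjP[e eA /joins_srctgtP[] [-> ->]];
by rewrite clU.
Qed.

Lemma spanning_connectedP A :
  reflect ((exists x : vert G, true) /\ forall x y, connect (adj A) x y)
    (spanning_connected A).
Proof.
apply: (iffP andP) => [[/card_gt0P[x _] /forallP C]|[[x _] C]].
  by split=> [|y z]; [exists x | have /forallP := C y].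
by split; [apply/card_gt0P; exists x | do 2![apply/forallP=> ?]].
Qed.

Lemma cut_not_connected A (U : {pred vert G}) x y :
  x \in U -> y \notin U ->
  (forall e, e \in A -> (src e \in U) = (tgt e \in U)) -> ~~ spanning_connected A.
Proof.
move=> xU yU clU; apply/negP => /spanning_connectedP[_ C].
by move: yU; rewrite -(connect_closedW clU (C x y)) xU.
Qed.

(** A path needs [e] at most once, in one of its two directions. For the forward implication, the
    right-hand side, seen as a set of [y], is closed under the edges of [e |: A]. *)
Lemma connect_setU1 A e x y :
  connect (adj (e |: A)) x y =
  [|| connect (adj A) x y,
      connect (adj A) x (src e) && connect (adj A) (tgt e) y
    | connect (adj A) x (tgt e) && connect (adj A) (src e) y].
Proof.
set B := e |: A; have sAB : A \subset B by apply: subsetUr.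
have se : connect (adj B) (src e) (tgt e).
  by apply/connect1/adj_edge/setU11.
have te : connect (adj B) (tgt e) (src e) by rewrite connect_adjC.
apply/idP/idP; last first.
  case/or3P => [|/andP[h1 h2]|/andP[h1 h2]]; first exact: connect_adjS.
    by apply: connect_trans (connect_adjS sAB h1) (connect_trans se (connect_adjS sAB h2)).
  by apply: connect_trans (connect_adjS sAB h1) (connect_trans te (connect_adjS sAB h2)).
pose U : {pred vert G} := fun y => 
  [|| connect (adj A) x y,
      connect (adj A) x (src e) && connect (adj A) (tgt e) y
    | connect (adj A) x (tgt e) && connect (adj A) (src e) y].
move=> C; rewrite -[X in is_true X]/(y \in U).
rewrite -(@connect_closedW B U x y) //; first by rewrite /in_mem /= /U connect0.
move=> f /setU1P[->|fA]; rewrite /in_mem /= /U.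
  rewrite !connect0 !andbT (connect_adjC A (tgt e) (src e)).
  by do 2![case: (connect _ x _)]; case: (connect _ (src e) _).
have sf z : connect (adj A) z (src f) = connect (adj A) z (tgt f).
  by rewrite !(connect_adjC A z); apply: (same_connect (connect_adjC A) (connect1 (adj_edge fA))).
by rewrite !sf.
Qed.


(* Induction on A: each added edge merges at most two components. *)
Lemma independent_transversal A :
  exists2 T : {set vert G}, (#|vert G| <= #|T| + #|A|)%N &
    {in T &, forall x y, connect (adj A) x y -> x = y}.
Proof.
have [n] := ubnP #|A|; elim: n => // n IHn in A *; rewrite ltnS => An.
have [->|[e eA]] := set_0Vmem A.
  exists setT => [|x y _ _ /connectP[[|z p] /= Pp ->]]; rewrite ?cardsT ?leq_addr //.
  by case/andP: Pp => /adjP[f]; rewrite inE.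
rewrite (cardsD1 e) eA add1n in An; have [T Tn Ti] := IHn _ An.
have eAe : e |: A :\ e = A by apply: setD1K.
have cA x y := connect_setU1 (A :\ e) e x y; rewrite eAe in cA.
pose B := A :\ e; have cC := connect_adjC B.
(* Adding [e] may merge the components of its ends; the representative of the component of [src e],
   if there is one, is given up. *)
pose t1 := [pick t in T | connect (adj B) t (src e)].
pose T' : {set vert G} := if t1 is Some t then T :\ t else T; exists T'.
  rewrite (cardsD1 e A) eA add1n addnS.
  apply: leq_trans Tn _; rewrite -addSn leq_add2r /T' /t1.
  by case: pickP => [t /andP[tT _]|_] //; rewrite (cardsD1 t T) tT.
have key x y : x \in T -> y \in T ->
    connect (adj B) x (src e) -> connect (adj B) (tgt e) y ->
    t1 = Some x.
  move=> xT yT xs ty; rewrite /t1; case: pickP => [t /andP[tT ts]|/(_ x)].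
    by congr Some; apply: Ti => //; apply: connect_trans ts _; rewrite cC.
  by rewrite xT xs.
move=> x y; rewrite cA => xT' yT'.
have sub u : u \in T' -> u \in T /\ t1 <> Some u.
  by rewrite /T'; case: (t1) => [t /setD1P[ut uT]|uT]; split=> // -[/esym/eqP]; apply/negP.
have [xT xt] := sub _ xT'; have [yT yt] := sub _ yT'.
case/or3P => [|/andP[xs ty]|/andP[xs ty]]; first exact: Ti.
  by case: xt; apply: key xs ty.
by case: yt; apply: (key y x); rewrite 1?cC.
Qed.

Lemma connected_card A : spanning_connected A -> (#|vert G| <= #|A|.+1)%N.
Proof.
move=> /spanning_connectedP[_ C]; have [T Tn Ti] := independent_transversal A.
apply: leq_trans Tn _; rewrite -add1n leq_add2r.
by apply/card_le1P => x xT y; rewrite inE; apply/idP/eqP => [yT|-> //]; apply: Ti.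
Qed.

Let step : rel (vert G * edge G) := fun xe yf => joins xe.2 xe.1 yf.1.

Lemma path_connect A q s p :
  path step q (rcons s p) -> all (fun xe => xe.2 \in A) (q :: s) ->
  connect (adj A) q.1 p.1.
Proof.
elim: s q => [|r s IHs] q /=.
  by rewrite !andbT => J qA; apply/connect1/adjP; exists q.2.
move=> /andP[J P] /andP[qA sA]; apply: connect_trans (IHs _ P sA).
by apply/connect1/adjP; exists q.2.
Qed.

(** The rest of the cycle joins the ends of its first edge and avoids that edge. *)
Lemma cycle_connect A c : graph_cycle A c ->
  exists2 e, e \in A & connect (adj (A :\ e)) (src e) (tgt e).
Proof.
case: c => [|[x e] c] // /and5P[_ _ /= /andP[ec _] /andP[eA cA] cyc].
exists e => //; suff: exists2 y, joins e x y & connect (adj (A :\ e)) y x.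
  by case=> y /joins_srctgtP[[-> ->]|[-> ->]]; rewrite 1?connect_adjC.
case: c ec cA cyc => [_ _ /= /andP[J _]|q c ec cA /= /andP[J P]].
  by exists x => //; apply: connect0.
exists q.1 => //; apply: (path_connect P); apply/allP => r rc.
rewrite !inE (allP cA) // andbT; apply: contra ec => /eqP<-.
exact: map_f.
Qed.

(** A path without repeated vertices between the ends of [e], avoiding [e], is closed up by [e]
    itself. *)
Lemma connect_cycle A e : e \in A ->
  connect (adj (A :\ e)) (src e) (tgt e) -> exists c, graph_cycle A c.
Proof.
move=> eA /connectP[p0 P0 L0].
(* [w] picks an edge of [B] for each step of the vertex path, with default [e], which is outside
   [B]; [build] pairs each vertex with the edge leaving it and gives [e] to the last one. *)
pose B := A :\ e; pose w x y := if [pick f in B | joins f x y] is Some f then f else e.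
have wP x y : adj B x y -> w x y \in B /\ joins (w x y) x y.
  move=> /adjP[f fB J]; rewrite /w; case: pickP => [g /andP[]|/(_ f)] //.
  by rewrite fB J.
pose fix build x p : seq (vert G * edge G) :=
  if p is y :: p' then (x, w x y) :: build y p' else [:: (x, e)].
have bfst x p : map fst (build x p) = x :: p.
  by elim: p x => //= y p IHp x; rewrite IHp.
have bsub x p f : path (adj B) x p -> f \in map snd (build x p) ->
    f = e \/ f \in B /\ ends f \subset x :: p.
  elim: p x => [|y p IHp] x /=; first by rewrite inE => _ /eqP; left.
  move=> /andP[xy P]; rewrite inE => /orP[/eqP->|]; last first.
    move=> /(IHp _ P)[->|[fB fs]]; [by left|right; split=> //].
    by apply: subset_trans fs _; apply/subsetP=> z zp; rewrite inE zp orbT.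
  have [wB /eqP->] := wP _ _ xy; right; split=> //.
  by apply/subsetP => z /set2P[]->; rewrite !inE eqxx ?orbT.
(* An edge chosen later has both ends further along the path, whereas the edge chosen at [x] has [x]
   as an end. *)
have buniq x p : path (adj B) x p -> uniq (x :: p) -> uniq (map snd (build x p)).
  elim: p x => [|y p IHp] x //= /andP[xy P] /andP[xp Up].
  rewrite IHp // andbT; apply/negP => /(bsub _ _ _ P).
  have [wB /eqP Ew] := wP _ _ xy; case=> [we|[_ /subsetP/(_ x)]].
    by move: wB; rewrite we !inE eqxx.
  by rewrite Ew !inE eqxx => /(_ isT); move: xp; rewrite inE => /negbTE->.
have bpath x p z : path (adj B) x p -> joins e (last x p) z.1 ->
    path step (head z (build x p)) (rcons (behead (build x p)) z).
  elim: p x => [|y p IHp] x /=; first by rewrite andbT.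
  move=> /andP[xy P] /(IHp _ P) {}IHp; have [_ J] := wP _ _ xy.
  by case: p P IHp => [|y' p] P IHp /=; rewrite /step /= J.
move: L0; have [p P U _] := shortenP P0 => L0.
have Eb : build (src e) p = head (src e, e) (build (src e) p) :: behead (build (src e) p).
  by case: (p).
exists (build (src e) p); apply/and5P; split.
- by rewrite Eb.
- by rewrite bfst.
- exact: buniq.
- apply/allP => z zb; have /(bsub _ _ _ P) : z.2 \in map snd (build (src e) p).
    exact: map_f.
  by case=> [->|[]] //; rewrite inE => /andP[].
- have Eh : (head (src e, e) (build (src e) p)).1 = src e by case: (p).
  have := bpath (src e) p (head (src e, e) (build (src e) p)) P.
  have J : joins e (tgt e) (src e) by apply/joins_srctgtP; right.
  by rewrite Eh -L0 => /(_ J); rewrite Eb.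
Qed.

(** Trades the cycle condition for a count. In an acyclic set each edge is a bridge, so there are no
    more than |V| - 1 edges; conversely, an edge of a cycle could be removed from a connected set
    that already has the least possible number of edges. *)
Lemma spanning_treeE A :
  spanning_tree A = spanning_connected A && (#|A|.+1 == #|vert G|).
Proof.
rewrite /spanning_tree; case cA: (spanning_connected A) => //=.
have cDe e : e \in A -> connect (adj (A :\ e)) (src e) (tgt e) ->
    spanning_connected (A :\ e).
  move=> eA C; apply/spanning_connectedP.
  have /spanning_connectedP[x0 CA] := cA; split=> // x y.
  have := CA x y; rewrite -{1}(setD1K eA) connect_setU1.
  case/or3P => // /andP[h1 h2]; apply: connect_trans h1 (connect_trans _ h2) => //.
  by rewrite connect_adjC.
apply/asboolP/eqP => [ac|Acard c]; last first.
  apply/negP => /cycle_connect[e eA /(cDe e eA)/connected_card].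
  by rewrite -Acard (cardsD1 e A) eA add1n ltnn.
apply/eqP; rewrite eqn_leq connected_card // andbT.
(* The counterpart of [independent_transversal]: when all edges are bridges, |V| - |A| vertices
   suffice to meet every component. *)
have [T Tn Ti] : exists2 T : {set vert G}, (#|T| + #|A| <= #|vert G|)%N &
    forall x, exists2 t, t \in T & connect (adj A) x t.
  have {cA cDe} : forall e, e \in A -> ~~ connect (adj (A :\ e)) (src e) (tgt e).
    by move=> e eA; apply/negP => /(connect_cycle eA)[c]; apply/negP.
  have [n] := ubnP #|A|; elim: n => // n IHn in A {ac} *; rewrite ltnS => An br.
  have [->|[e eA]] := set_0Vmem A.
    by exists setT => [|x]; [rewrite cardsT cards0 addn0|exists x].
  rewrite (cardsD1 e) eA add1n in An; have [|T Tn Ti] := IHn _ An.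
    move=> f fA; apply: contra (br f (subsetP (subsetDl _ _) _ fA)).
    by apply: connect_adjS; apply/setSD/subsetDl.
  have [t tT te] := Ti (tgt e); have [s sT se] := Ti (src e).
  exists (T :\ t); first rewrite (cardsD1 e A) eA.
    by move: Tn; rewrite (cardsD1 t T) tT addnA [(_ + 1)%N]addnC.
  have cA := connect_adjS (subsetDl A [set e]).
  move=> x; have [u uT ux] := Ti x; case: (eqVneq u t) => [ut|ut]; last first.
    by exists u; rewrite ?inE ?ut // cA.
  exists s.
    rewrite !inE sT andbT; apply: contraNneq (br e eA) => st.
    by apply: connect_trans se _; rewrite st connect_adjC.
  apply: connect_trans (cA _ _ ux) _; rewrite ut connect_adjC.
  apply: connect_trans (connect_trans (connect1 (adj_edge eA)) (cA _ _ te)).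
  by rewrite connect_adjC; apply: cA.
apply: leq_trans _ Tn; rewrite -add1n leq_add2r card_gt0; apply/set0Pn.
have /spanning_connectedP[[x _] _] := cA; have [t tT _] := Ti x.
by exists t.
Qed.

End Connectivity.

(** * Reliability near 0 and near 1 *)

Definition nb_deletions (G : mgraph) (j : nat) : nat :=
  #|[set X : {set edge G} | (#|X| == j) && spanning_connected (~: X)]|.

Lemma sum_nb_deletions G : (\sum_(j < #|edge G|.+1) nb_deletions G j <= 2 ^ #|edge G|)%N.
Proof.
have <- : #|{set edge G}| = (2 ^ #|edge G|)%N.
  by rewrite -[in RHS]cardsT -card_powerset powersetT cardsT.
rewrite -[X in (_ <= X)%N]sum1_card.
rewrite (partition_big (fun X : {set edge G} => inord #|X| : 'I_(#|edge G|.+1)) predT) //=.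
apply: leq_sum => j _; rewrite sum1_card; apply/subset_leq_card/subsetP=> X.
rewrite inE => /andP[/eqP Xj _]; rewrite unfold_in /=.
by rewrite inordK Xj // ?eqnE ?eqxx.
Qed.

Lemma nb_spanning_treesE G j :
  (#|edge G|).+1 = (#|vert G| + j)%N -> nb_spanning_trees G = nb_deletions G j.
Proof.
move=> Ej; rewrite /nb_spanning_trees /nb_deletions -(card_imset _ (@setC_inj _)).
apply: eq_card => X; apply/imsetP/idP => [[A]|].
  rewrite !inE => + ->; rewrite spanning_treeE setCK => /andP[-> /eqP Ac].
  rewrite andbT cardsCs setCK; apply/eqP.
  by apply/eqP; rewrite -(eqn_add2l #|A|) subnKC ?max_card // -eqSS -addSn Ac Ej.
rewrite inE => /andP[/eqP Xj cX]; exists (~: X); last by rewrite setCK.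
rewrite inE spanning_treeE cX /= cardsCs setCK Xj -(eqn_add2r j) -Ej addSn subnK //.
by rewrite -Xj max_card.
Qed.

Section Reliability.
Local Open Scope ring_scope.
Variable R : realType.
Implicit Types (G H : mgraph) (p : R).

Lemma reliabilityE G p :
  reliability G p = \sum_(j < #|edge G|.+1)
     (nb_deletions G j)%:R * (p ^+ (#|edge G| - j) * (1 - p) ^+ j).
Proof.
rewrite /reliability (reindex_inj (@setC_inj _)) /=.
rewrite (partition_big (fun X : {set edge G} => inord #|X| : 'I_(#|edge G|.+1)) predT) //=.
have cX (X : {set edge G}) : #|~: X| = (#|edge G| - #|X|)%N.
  by rewrite cardsCs setCK.
apply: eq_bigr => j _; rewrite (eq_bigr (fun=> p ^+ (#|edge G| - j) * (1 - p) ^+ j)).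
  rewrite sumr_const mulr_natl.
  congr (_ *+ _);apply: eq_card => X.
  rewrite !inE unfold_in /= andbC; congr (_ && _).
  by rewrite -val_eqE /= inordK // ltnS max_card.
move=> X /andP[_ /eqP<-]; rewrite inordK ?ltnS ?max_card // cX subKn //.
exact: max_card.
Qed.

(** With x = 1 - p, the terms of [b] beyond [k] total at most 2^m x^(k+1), while index [k] gains at
    least p^(m-k) x^k. The bound x < 4^-(m+1) gives 2^m x < 2^-m <= p^m <= p^(m-k). *)
Lemma bernstein_lt_near1 (m k : nat) (a b : nat -> nat) p : (k <= m)%N ->
    (forall j, (j < k)%N -> a j = b j) -> (b k < a k)%N ->
    (\sum_(j < m.+1) b j <= 2 ^ m)%N -> 1 - 4^-1 ^+ m.+1 < p < 1 ->
  \sum_(j < m.+1) (b j)%:R * (p ^+ (m - j) * (1 - p) ^+ j) <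
  \sum_(j < m.+1) (a j)%:R * (p ^+ (m - j) * (1 - p) ^+ j).
Proof.
move=> km eq_ab lt_ab sum_b /andP[p0 p1].
set x := 1 - p; have x0 : 0 < x by rewrite subr_gt0.
have x4 : x < 4^-1 ^+ m.+1 by rewrite /x; lra.
have i4 n : (4^-1 : R) ^+ n <= 1 by rewrite exprn_ile1 //; lra.
have p2 : 2^-1 <= p.
  by have := i4 m; move: x4; rewrite exprS /x => *; lra.
have x1 : x <= 1 by rewrite /x; lra.
pose t j : R := p ^+ (m - j) * x ^+ j.
have t0 j : 0 <= t j by rewrite mulr_ge0 ?exprn_ge0 //; lra.
(* The error [b j * x ^+ k.+1] is charged to every index, so that the errors add up through
   [sum_b]. *)
have pw (j : 'I_m.+1) : (b j)%:R * t j <=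
    (a j)%:R * t j - (if (j : nat) == k then t k else 0) + (b j)%:R * x ^+ k.+1.
  have [jk|kj|jk] := ltngtP (j : nat) k.
  - by rewrite subr0 eq_ab // lerDl mulr_ge0 ?ler0n ?exprn_ge0 // ltW.
  - rewrite subr0; apply: ler_wpDl; first by rewrite mulr_ge0 ?ler0n.
    apply: ler_wpM2l; first exact: ler0n.
    apply: (@le_trans _ _ (x ^+ j)).
      by rewrite ler_piMl ?exprn_ge0 ?exprn_ile1 //; lra.
    by rewrite ler_wiXn2l // ltW.
  - rewrite jk; apply: ler_wpDr; first by rewrite mulr_ge0 ?ler0n ?exprn_ge0 ?(ltW x0).
    rewrite -[X in _ - X]mul1r -mulrBl; apply: ler_wpM2r => //.
    by rewrite lerBrDr natr1 ler_nat.
apply: le_lt_trans (ler_sum _ (fun j _ => pw j)) _.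
rewrite big_split sumrB /= -addrA gtrDl.
rewrite -big_mkcond (big_pred1 (Ordinal (km : (k < m.+1)%N))) //= -mulr_suml -natr_sum.
rewrite addrC subr_lt0 /t exprS mulrA.
rewrite ltr_pM2r ?exprn_gt0 //.
apply: (@le_lt_trans _ _ (2 ^+ m * x)).
  by apply: ler_wpM2r; [exact: ltW | rewrite -natrX ler_nat].
apply: (@lt_le_trans _ _ (2^-1 ^+ m)).
  have -> : (2^-1 : R) ^+ m = 2 ^+ m * 4^-1 ^+ m.
    by rewrite -exprMn; congr (_ ^+ m); lra.
  rewrite ltr_pM2l ?exprn_gt0 //; apply: lt_le_trans x4 _.
  by rewrite ler_wiXn2l //; lra.
apply: (@le_trans _ _ (p ^+ m)); first by rewrite lerXn2r ?nnegrE //; lra.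
by rewrite ler_wiXn2l ?leq_subr //; lra.
Qed.

(** Reversing the indices exchanges [p] and [1 - p]. *)
Lemma bernstein_lt_near0 (m k : nat) (a b : nat -> nat) p : (k <= m)%N ->
    (forall j, (k < j)%N -> (j <= m)%N -> a j = b j) -> (b k < a k)%N ->
    (\sum_(j < m.+1) b j <= 2 ^ m)%N -> 0 < p < 4^-1 ^+ m.+1 ->
  \sum_(j < m.+1) (b j)%:R * (p ^+ (m - j) * (1 - p) ^+ j) <
  \sum_(j < m.+1) (a j)%:R * (p ^+ (m - j) * (1 - p) ^+ j).
Proof.
move=> km eq_ab lt_ab sum_b /andP[p0 p1].
have rev (c : nat -> nat) : \sum_(j < m.+1) (c j)%:R * (p ^+ (m - j) * (1 - p) ^+ j) =
   \sum_(j < m.+1) (c (m - j)%N)%:R * ((1 - p) ^+ (m - j) * (1 - (1 - p)) ^+ j).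
  rewrite (reindex_inj rev_ord_inj); apply: eq_bigr => j _ /=.
  have jm : (j <= m)%N by rewrite -ltnS.
  rewrite subSS (subKn jm) (_ : 1 - (1 - p) = p) ?subKr //.
  by congr (_ * _); rewrite mulrC.
rewrite (rev a) (rev b); apply: (@bernstein_lt_near1 m (m - k)
  (fun j => a (m - j)%N) (fun j => b (m - j)%N)); first exact: leq_subr.
- by move=> j jk; apply: eq_ab; rewrite ?leq_subr // ltn_subCr.
- by rewrite subKn.
- rewrite (reindex_inj rev_ord_inj) /=; apply: leq_trans sum_b.
  by apply/eq_leq/eq_bigr => j _; rewrite subSS subKn // -ltnS.
- by apply/andP; split; lra.
Qed.

End Reliability.

(** * Subdivisions *)

Section Morphisms.
Variables (G H : mgraph) (f : vert G -> vert H).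
Variables (A : {set edge G}) (B : {set edge H}).
Hypothesis fE : forall e, e \in A -> connect (adj B) (f (src e)) (f (tgt e)).

Lemma connect_morph x y :
  connect (adj A) x y -> connect (adj B) (f x) (f y).
Proof.
pose U : {pred vert G} := fun z => connect (adj B) (f x) (f z).
move=> C; rewrite -[X in is_true X]/(y \in U) -(connect_closedW _ C).
  by rewrite /U /in_mem /= connect0.
move=> e /fE se; rewrite /in_mem /= /U.
rewrite !(connect_adjC B (f x)); exact: (same_connect (connect_adjC B) se).
Qed.

(** Since [fE] asks only for connected images of the ends of an edge, this covers isomorphisms, the
    inclusion of a graph into its subdivision and the retraction back. *)
Lemma spanning_connected_morph :
  (forall y, exists x, connect (adj B) (f x) y) ->
  spanning_connected A -> spanning_connected B.
Proof.
move=> surj /spanning_connectedP[[x0 _] C]; apply/spanning_connectedP.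
split=> [|y z]; first by exists (f x0).
have [x xy] := surj y; have [u uz] := surj z.
rewrite connect_adjC in xy; apply: connect_trans xy (connect_trans _ uz).
exact: connect_morph.
Qed.

End Morphisms.

Section Isomorphism.
Implicit Types G H : mgraph.

Lemma isomorphic_refl G : isomorphic G G.
Proof. by exists id, id; split=> [||e]; [exists id|exists id|rewrite imset_id]. Qed.

Lemma isomorphic_sym G H : isomorphic G H -> isomorphic H G.
Proof.
move=> [f [g [[f' fK f'K] [g' gK g'K] E]]]; exists f', g'; split.
- by exists f.
- by exists g.
move=> e; rewrite -{2}(g'K e) E -imset_comp.
by rewrite (eq_imset (g := id)) ?imset_id // => x /=; rewrite fK.
Qed.

Lemma isomorphic_card G H : isomorphic G H ->
  #|vert G| = #|vert H| /\ #|edge G| = #|edge H|.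
Proof.
by move=> [f [g [bf bg _]]]; rewrite (bij_eq_card bf) (bij_eq_card bg).
Qed.

Lemma connected_imset G H (f : vert G -> vert H) (g : edge G -> edge H) A :
  bijective f -> (forall e, ends (g e) = f @: ends e) ->
  spanning_connected A -> spanning_connected (g @: A).
Proof.
move=> [f' fK f'K] E; apply: (@spanning_connected_morph _ _ f) => [e eA|y].
  apply/connect1/adjP; exists (g e); first exact: imset_f.
  by rewrite /joins E /ends imsetU1 imset_set1.
by exists (f' y); rewrite f'K.
Qed.

Lemma isomorphic_nb_deletions_le G H j :
  isomorphic G H -> (nb_deletions G j <= nb_deletions H j)%N.
Proof.
move=> [f [g [bf bg E]]]; have gI := bij_inj bg; rewrite /nb_deletions.
rewrite -(card_imset _ (imset_inj gI)); apply/subset_leq_card/subsetP => Y.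
case/imsetP=> X; rewrite !inE => /andP[/eqP Xj cX] ->.
rewrite card_imset // Xj eqxx /=.
suff <- : g @: (~: X) = ~: (g @: X) by apply: connected_imset bf E cX.
case: bg => g' gK g'K; apply/setP => e; rewrite -(g'K e) (mem_imset _ _ gI).
by rewrite !inE (mem_imset _ _ gI).
Qed.

Lemma isomorphic_nb_deletions G H j :
  isomorphic G H -> nb_deletions G j = nb_deletions H j.
Proof.
move=> I; apply/eqP; rewrite eqn_leq !isomorphic_nb_deletions_le //.
exact: isomorphic_sym.
Qed.

End Isomorphism.

(** A set that [pi] maps bijectively onto [S] is the image of a unique choice of one point in each
    fibre over [S]; [pfamily] counts these choices. An empty [A] offers no default value and is
    treated apart. *)
Lemma card_transversal_sets (A E : finType) (pi : A -> E) (S : {set E}) :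
  #|[set X : {set A} | (pi @: X == S) && (#|X| == #|S|)]| =
  \prod_(e in S) #|[set a | pi a == e]|.
Proof.
case: (pickP (fun _ : A => true)) => [a0 _|A0]; last first.
  have X0 (X : {set A}) : X = set0 by apply/setP=> a; have := A0 a.
  have [->|[e eS]] := set_0Vmem S.
    rewrite big1 ?(eq_card (B := [set set0])) ?cards1 //.
      by move=> X; rewrite !inE [X]X0 imset0 !cards0 !eqxx.
    by move=> e; rewrite inE.
  rewrite (bigD1 e) //= (X0 [set a | pi a == e]) cards0 mul0n.
  apply/eqP; rewrite cards_eq0; apply/eqP/setP=> X; rewrite !inE [X]X0 imset0.
  by apply/negP => /andP[/eqP S0]; move: eS; rewrite -S0 inE.
pose F e := [set a | pi a == e].
transitivity #|pfamily a0 (mem S) F|; last first.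
  by rewrite card_pfamily foldrE big_map big_enum.
pose img (f : {ffun E -> A}) := f @: S.
have fP f : f \in pfamily a0 (mem S) F ->
    (forall e, e \in S -> pi (f e) = e) /\ (forall e, e \notin S -> f e = a0).
  move=> /pfamilyP[sup fF]; split=> e eS; first by have := fF e eS; rewrite inE => /eqP.
  by apply/eqP; apply: contraR eS => fe; apply: (subsetP sup).
rewrite -(card_in_imset (f := img)); last first.
  move=> f g /fP[f1 f2] /fP[g1 g2] fg; apply/ffunP => e.
  have [eS|eS] := boolP (e \in S); last by rewrite f2 // g2.
  have : f e \in img g by rewrite -fg imset_f.
  by case/imsetP => e' e'S fe; have := f1 e eS; rewrite fe g1 // => ->.
apply: eq_card => X; rewrite !inE; apply/andP/imsetP => [[/eqP XS /eqP cX]|[f /fP[f1 f2] ->]].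
  have piI : {in X &, injective pi} by apply/imset_injP; rewrite XS cX.
  pose f := [ffun e => if e \in S then odflt a0 [pick a in X | pi a == e] else a0].
  have fX e : e \in S -> f e \in X /\ pi (f e) = e.
    move=> eS; rewrite ffunE eS; case: pickP => [a /andP[aX /eqP]|] //=.
    by move: eS; rewrite -XS => /imsetP[a aX ->] /(_ a); rewrite aX eqxx.
  exists f.
    apply/pfamilyP; split=> [|e /fX[_ fe]]; last by rewrite inE fe.
    by apply/subsetP => e; rewrite inE ffunE; case: ifP => //; rewrite eqxx.
  apply/setP => a; apply/idP/imsetP => [aX|[e /fX[fX' _] ->] //].
  have eS : pi a \in S by rewrite -XS imset_f.
  by exists (pi a) => //; have [? ?] := fX _ eS; apply: piI.
split; apply/eqP.
  rewrite /img -imset_comp -[RHS]imset_id; apply: eq_in_imset => e eS /=; exact: f1.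
rewrite card_in_imset // => e e' eS e'S fe.
by rewrite -(f1 e eS) fe f1.
Qed.

Definition weighted_deletions (G : mgraph) (w : edge G -> nat) (j : nat) : nat :=
  \sum_(X : {set edge G} | (#|X| == j) && spanning_connected (~: X))
     \prod_(e in X) w e.

Section Subdivision.
Variables (K : mgraph) (l : edge K -> nat).
Hypothesis l_gt0 : forall e, (0 < l e)%N.
Local Notation H := (subdivide l).
Local Notation cv := (@chain_vert K l).
Implicit Types (e : edge K) (X : {set edge H}).

Lemma chain_vert_end e : cv e (l e) = inl (tgt e).
Proof.
by rewrite -(prednK (l_gt0 e)) /chain_vert insubN // ltnn.
Qed.

Lemma chain_vert_inner e (j : 'I_(l e).-1) :
  cv e j.+1 = inr (@Tagged _ e (fun e => 'I_(l e).-1) j).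
Proof. by rewrite /chain_vert valK. Qed.

Lemma subdivide_vertP (P : vert H -> Prop) :
  (forall x, P (inl x)) -> (forall e k, 0 < k -> k < l e -> P (cv e k)) ->
  forall v, P v.
Proof.
move=> Pl Pr [//|[e j]].
have -> : inr (existT (fun e => 'I_(l e).-1) e j) = cv e j.+1 by rewrite chain_vert_inner.
by apply: Pr => //; rewrite -ltn_predRL.
Qed.

Lemma card_subdivide_vert :
  (#|vert H| + #|edge K| = #|vert K| + \sum_e l e)%N.
Proof.
rewrite card_sum card_tagged sumnE big_map big_enum -addnA; congr addn.
rewrite -sum1_card -big_split /=; apply: eq_bigr => e _.
by rewrite card_ord addn1 prednK.
Qed.

Lemma card_subdivide_edge : #|edge H| = \sum_e l e.
Proof.
by rewrite card_tagged sumnE big_map big_enum; apply: eq_bigr => e _; rewrite card_ord.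
Qed.

Lemma card_chain e : #|[set a : edge H | tag a == e]| = l e.
Proof.
rewrite -[RHS]card_ord -(card_codom (f := @Tagged _ e (fun e => 'I_(l e)))).
  apply: eq_card => -[e' j]; rewrite inE /=; apply/eqP/codomP => [E|[i]].
    by subst e'; exists j.
  by move/(congr1 tag).
by move=> i j /eqP; rewrite eq_Tagged => /eqP.
Qed.

Let te e (i : 'I_(l e)) : edge H := @Tagged _ e (fun e => 'I_(l e)) i.

Lemma chain_connect X e i j : (i <= j <= l e)%N ->
  (forall k : 'I_(l e), (i <= k < j)%N -> te k \notin X) ->
  connect (adj (~: X)) (cv e i : vert H) (cv e j).
Proof.
elim: j => [|j IHj] /andP[ij jl] Xij.
  by move: ij; rewrite leqn0 => /eqP->.
move: ij; rewrite leq_eqVlt => /predU1P[->//|]; rewrite ltnS => ij.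
apply: (@connect_trans _ _ (cv e j)).
  apply: IHj => [|k /andP[ik kj]]; first by rewrite ij ltnW.
  by rewrite Xij // ik ltnW.
apply/connect1/(@adj_edge H (~: X) (te (Ordinal jl))).
by rewrite inE Xij //= ij /=.
Qed.

(** With at most one deleted edge per chain, every inner vertex still reaches an end of its chain:
    the target if a deleted edge precedes it, the source otherwise. *)
Lemma subdivide_connected_from X :
  {in X &, injective (@tag _ (fun e => 'I_(l e)))} ->
  spanning_connected (~: [set tag a | a in X]) -> spanning_connected (~: X).
Proof.
move=> tI; apply: (@spanning_connected_morph K H inl) => [e|].
  rewrite inE => eX; rewrite -[inl (src e)]/(cv e 0) -chain_vert_end.
  apply: chain_connect => [|k _]; first by rewrite leqnn.
  apply: contra eX => kX.
  by apply/imsetP; exists (te k).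
apply: subdivide_vertP => [x|e k k0 kl]; first by exists x.
case: (pickP [pred i : 'I_(l e) | (i < k)%N && (te i \in X)]) => [i|nX].
  move=> /andP[ik iX]; exists (tgt e); rewrite connect_adjC -chain_vert_end.
  apply: chain_connect => [|i' /andP[ki' _]]; first by rewrite leqnn ltnW.
  apply/negP => i'X; have /(_ erefl) := tI _ _ iX i'X.
  move/eqP; rewrite eq_Tagged => /eqP ii'; by move: ki'; rewrite -ii' leqNgt ik.
exists (src e); rewrite -[inl _]/(cv e 0); apply: chain_connect => [|i /= ik].
  exact: ltnW.
by have := nX i; rewrite /= ik /= => ->.
Qed.

(** The retraction [f] sends an inner vertex to the target of its chain if a deleted edge precedes
    it and to the source otherwise. The remaining edges of a cut chain collapse to points; in an
    uncut chain only the last edge survives, as the edge of [K]. *)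
Lemma subdivide_connected_to X :
  {in X &, injective (@tag _ (fun e => 'I_(l e)))} ->
  spanning_connected (~: X) -> spanning_connected (~: [set tag a | a in X]).
Proof.
move=> tI.
pose crossed e k := [exists i : 'I_(l e), (i < k)%N && (te i \in X)].
pose f (v : vert H) : vert K := match v with
  | inl x => x
  | inr s => if crossed (tag s) (tagged s).+1 then tgt (tag s) else src (tag s)
  end.
have fcv e k : (k < l e)%N -> f (cv e k) = if crossed e k then tgt e else src e.
  case: k => [_|k kl].
    by rewrite /=; case: ifP => // /existsP[i].
  have kl' : (k < (l e).-1)%N by rewrite ltn_predRL.
  by rewrite -[k]/(val (Ordinal kl')) chain_vert_inner.
apply: (@spanning_connected_morph H K f); last by move=> x; exists (inl x).
move=> [e i]; rewrite inE -/(te i) => iX.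
change (is_true (connect (adj (~: [set tag a | a in X])) (f (cv e i)) (f (cv e i.+1)))).
rewrite fcv //.
have ce : adj (~: [set tag a | a in X]) (src e) (tgt e) \/
    (exists i0 : 'I_(l e), te i0 \in X).
  case: (boolP (e \in [set tag a | a in X])) => [/imsetP[[e' i0] X0 /= E]|eX].
    by right; subst e'; exists i0.
  by left; apply: adj_edge; rewrite inE.
case: ce => [ce|[i0 i0X]].
  have c2 : connect (adj (~: [set tag a | a in X])) (tgt e) (src e).
    by rewrite connect_adjC connect1.
  have [il|il] := ltnP i.+1 (l e).
    by rewrite fcv //; do 2![case: ifP => _]; rewrite ?connect0 // connect1.
  have -> : i.+1 = l e by apply/eqP; rewrite eqn_leq il ltn_ord.
  by rewrite chain_vert_end /=; case: ifP => _; rewrite ?connect0 // connect1.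
have cr k : crossed e k = (i0 < k)%N.
  apply/existsP/idP => [[i1 /andP[ik i1X]]|ik]; last by exists i0; rewrite ik.
  suff <- : i1 = i0 by [].
  have /eqP := tI _ _ i1X i0X erefl; by rewrite eq_Tagged => /eqP.
have ii0 : (i0 : nat) != i.
  by apply: contra iX => /eqP/val_inj<-.
have -> : f (cv e i.+1) = if (i0 < i.+1)%N then tgt e else src e.
  have [il|il] := ltnP i.+1 (l e); first by rewrite fcv // cr.
  have -> : i.+1 = l e by apply/eqP; rewrite eqn_leq il ltn_ord.
  by rewrite chain_vert_end /= ltn_ord.
by rewrite cr ltnS [(i0 <= i)%N]leq_eqVlt (negbTE ii0) connect0.
Qed.

(** Two deleted edges of one chain cut off the segment between them. *)
Lemma subdivide_connected_tag_inj X :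
  spanning_connected (~: X) -> {in X &, injective (@tag _ (fun e => 'I_(l e)))}.
Proof.
move=> cX; suff lt e (i j : 'I_(l e)) : te i \in X -> te j \in X -> ~~ (i < j)%N.
  move=> [e i] [e' j] /= iX jX E; subst e'; congr existT; apply/val_inj/eqP.
  by rewrite eqn_leq; apply/andP; split; rewrite leqNgt lt.
move=> iX jX; apply: contraL cX => ij.
(* The inner vertex numbered [tagged s] has position [(tagged s).+1] on its chain, and [U] holds the
   positions from i + 1 to j. *)
pose U (v : vert H) := if v is inr s then (tag s == e) && (i < (tagged s).+1 <= j)%N
  else false.
have Ucv e' k : (k <= l e')%N -> U (cv e' k) = (e' == e) && (i < k <= j)%N.
  case: k => [|k] kl; first by rewrite /= andbF.
  have [kl'|kl'] := ltnP k (l e').-1.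
    by rewrite -[k]/(val (Ordinal kl')) chain_vert_inner.
  have ke : k.+1 = l e' by case: (l e') kl kl' => //= n ? ?; lia.
  rewrite ke chain_vert_end /=; case: eqP => //= E; subst e'.
  by apply/esym/negbTE; rewrite negb_and orbC -ltnNge ltn_ord.
apply: (@cut_not_connected H _ U (cv e j) (cv e 0)).
- by rewrite /in_mem /= Ucv ?eqxx ?ij /= ?leqnn // ltnW.
- by [].
- move=> [e' k]; rewrite inE => kX; rewrite /in_mem /=.
  rewrite (Ucv e' k) ?(Ucv e' k.+1) //; last exact: ltnW.
  case: eqP => //= E; subst e'.
  have ki : (k : nat) != i by apply: contra kX => /eqP/val_inj->.
  have kj : (k : nat) != j by apply: contra kX => /eqP/val_inj->.
  by rewrite -!/(te _) in kX; move: ki kj; lia.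
Qed.

Lemma subdivide_connectedE X :
  spanning_connected (~: X) =
  (#|X| == #|[set tag a | a in X]|) && spanning_connected (~: [set tag a | a in X]).
Proof.
apply/idP/andP => [cX|[/eqP/esym/eqP/imset_injP tI]]; last exact: subdivide_connected_from.
have tI := subdivide_connected_tag_inj cX.
by rewrite card_in_imset //; split=> //; apply: subdivide_connected_to.
Qed.

(** Deletions are grouped by the set of chains they hit; within each hit chain the deleted edge is
    free. *)
Lemma nb_deletions_subdivide j : nb_deletions H j = weighted_deletions l j.
Proof.
rewrite /nb_deletions -sum1_card.
rewrite (partition_big (fun X : {set edge H} => [set tag a | a in X])
   (fun S : {set edge K} => (#|S| == j) && spanning_connected (~: S))) /=.
  apply: eq_bigr => S /andP[/eqP Sj cS].
  under [RHS]eq_bigr do rewrite -card_chain.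
  rewrite -(card_transversal_sets (fun a : edge H => tag a)) sum1_card.
  apply: eq_card => X; rewrite !inE unfold_in /= inE subdivide_connectedE.
  case: (eqVneq [set tag a | a in X] S) => [->|]; last by rewrite andbF.
  by rewrite andbT cS andbT Sj andbb.
by move=> X; rewrite inE subdivide_connectedE => /andP[/eqP<- /andP[/eqP-> ->]]; rewrite eqxx.
Qed.

End Subdivision.

Lemma subdivide_class K (l : edge K -> nat) : (forall e, 0 < l e)%N -> connected K ->
  connected (subdivide l).
Proof.
rewrite /connected => l0 cK; rewrite -setC0 (subdivide_connectedE l0) imset0 !cards0 eqxx.
by rewrite setC0.
Qed.

(** * Suppression of vertices of degree 2 *)

Lemma surj_card_bij (T U : finType) (f : T -> U) :
  (forall y, exists x, f x = y) -> #|T| = #|U| -> bijective f.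
Proof.
move=> surj TU; apply: inj_card_bij; last by rewrite TU.
suff /eqP/image_injP fI : #|[seq f x | x in T]| = #|T| by move=> x y; apply: fI.
rewrite TU; apply: eq_card => y; rewrite !inE; have [x <-] := surj y.
exact: codom_f.
Qed.

(* [c e k] is the k-th vertex and [d e k] the k-th edge of the chain replacing *)
(* [e]; only [k <= l e], resp. [k < l e], is meaningful.  Injectivity follows  *)
(* from surjectivity and the two cardinality conditions.                       *)
Definition chain_decomposition (H K : mgraph) (l : edge K -> nat) : Prop :=
  [/\ forall e, (0 < l e)%N,
      (#|vert H| + #|edge K| = #|vert K| + #|edge H|)%N,
      \sum_e l e = #|edge H|
    & exists (b : vert K -> vert H) (c : edge K -> nat -> vert H)
             (d : edge K -> nat -> edge H),
      [/\ forall e, c e 0 = b (src e) /\ c e (l e) = b (tgt e),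
          forall e k, (k < l e)%N -> ends (d e k) = [set c e k; c e k.+1],
          forall a, exists e k, (k < l e)%N /\ d e k = a
        & forall v, (exists x, b x = v) \/ exists e k, (0 < k < l e)%N /\ c e k = v]].

Section ChainDecomposition.
Variable H : mgraph.
Implicit Types K : mgraph.

Lemma chain_decomposition_isomorphic K (l : edge K -> nat) :
  chain_decomposition H l -> isomorphic H (subdivide l).
Proof.
move=> [l0 cV cE [b [c [d [cb dE dS vS]]]]]; apply: isomorphic_sym.
pose f (v : vert (subdivide l)) : vert H := match v with
  | inl x => b x
  | inr s => c (tag s) (tagged s).+1
  end.
pose g (a : edge (subdivide l)) : edge H := d (tag a) (tagged a).
have fcv e k : (k <= l e)%N -> f (chain_vert l e k) = c e k.
  case: k => [_|k kl] /=; first by have [] := cb e.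
  have [kl'|kl'] := ltnP k (l e).-1.
    by rewrite (insubT (fun k => k < (l e).-1)%N kl').
  rewrite insubN -?leqNgt //= -[RHS]/(c e k.+1); have [_ <-] := cb e.
  by congr c; have := l0 e; lia.
exists f, g; split.
- apply: surj_card_bij => [v|].
    have [[x <-]|[e [k [/andP[k0 kl] <-]]]] := vS v; first by exists (inl x).
    by exists (chain_vert l e k); rewrite fcv // ltnW.
  by apply/eqP; rewrite -(eqn_add2r #|edge K|) card_subdivide_vert // cV cE.
- apply: surj_card_bij => [a|]; last by rewrite card_subdivide_edge.
  have [e [k [kl <-]]] := dS a.
  by exists (@Tagged _ e (fun e => 'I_(l e)) (Ordinal kl)).
move=> [e k]; rewrite /g /= dE ?ltn_ord // /ends /= imsetU1 imset_set1.
by have := fcv e k.+1 (ltn_ord k) => /= ->; rewrite fcv // ltnW.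
Qed.

Lemma chain_decomposition_refl : @chain_decomposition H H (fun _ => 1%N).
Proof.
split=> //; first by rewrite sum1_card.
exists id, (fun e k => if k is 0 then src e else tgt e), (fun e _ => e).
split=> // [e [|k]|a|v] //; first by exists a, 0%N.
by left; exists v.
Qed.

Lemma chain_decomposition_iso K K' (l : edge K -> nat)
    (f : vert K' -> vert K) (g : edge K' -> edge K) :
  bijective f -> bijective g -> (forall e, ends (g e) = f @: ends e) ->
  chain_decomposition H l -> @chain_decomposition H K' (l \o g).
Proof.
move=> bf bg E [l0 cV cE [b [c [d [cb dE dS vS]]]]].
have gS e : exists e', g e' = e by have [g' _ g'K] := bg; exists (g' e).
(* [g e] may be oriented against [e]; its chain is then traversed backwards. *)
pose flip e := ~~ ((f (src e) == src (g e)) && (f (tgt e) == tgt (g e))).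
pose c' e k := if flip e then c (g e) (l (g e) - k)%N else c (g e) k.
pose d' e k := if flip e then d (g e) ((l (g e)).-1 - k)%N else d (g e) k.
have flipE e : flip e -> f (src e) = tgt (g e) /\ f (tgt e) = src (g e).
  move=> fl; have : joins (g e) (f (src e)) (f (tgt e)).
    by rewrite /joins E /ends imsetU1 imset_set1.
  by case/joins_srctgtP=> -[s t] //; move: fl; rewrite /flip s t !eqxx.
have [f' fK f'K] := bf.
split=> [e||  |]; first exact: l0.
- by rewrite (bij_eq_card bf) (bij_eq_card bg).
- rewrite -cE (reindex g) //; exact: onW_bij.
exists (b \o f), c', d'; split.
- move=> e; rewrite /c'; have [c0 cl] := cb (g e).
  case: (boolP (flip e)) => [/flipE[s t]|]; rewrite /= ?subn0 ?subnn ?s ?t //.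
  by rewrite /flip negbK => /andP[/eqP-> /eqP->].
- move=> e k /= kl; rewrite /d' /c'; case: ifP => _; last exact: dE.
  have kl' : ((l (g e)).-1 - k < l (g e))%N by have := l0 (g e); lia.
  have -> : (l (g e) - k = ((l (g e)).-1 - k).+1)%N by lia.
  have -> : (l (g e) - k.+1 = (l (g e)).-1 - k)%N by lia.
  by rewrite dE // setUC.
- move=> a; have [e [k [kl <-]]] := dS a; have [e' ee] := gS e; subst e.
  exists e', (if flip e' then (l (g e')).-1 - k else k)%N.
  by rewrite /d' /=; case: ifP => // _; split; [lia|congr d; lia].
move=> v; have [[x <-]|[e [k [kl <-]]]] := vS v.
  by left; exists (f' x); rewrite /= f'K.
right; have [e' ee] := gS e; subst e.
exists e', (if flip e' then l (g e') - k else k)%N.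
by rewrite /c' /=; case: ifP => // _; split; [lia|congr c; lia].
Qed.

Section Suppress.
Variables (K : mgraph) (l : edge K -> nat) (v : vert K) (e f : edge K).
Hypotheses (ef : e != f) (te : tgt e = v) (sf : src f = v).
Hypotheses (se : src e != v) (tf : tgt f != v).
Hypothesis other : forall g, g != e -> g != f -> src g != v /\ tgt g != v.

Definition suppress_default : {x | x \in predC1 v} := exist _ (src e) se.

Definition suppress : mgraph :=
  @MGraph {x | x \in predC1 v} {g | g \in predC1 f}
    (fun g => insubd suppress_default (src (val g)))
    (fun g => insubd suppress_default (tgt (if val g == e then f else val g))).

Definition suppress_length (g : edge suppress) : nat :=
  if val g == e then (l e + l f)%N else l (val g).

Lemma suppress_chain_decomposition :
  chain_decomposition H l -> chain_decomposition H suppress_length.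
Proof.
move=> [l0 cV cE [b [c [d [cb dE dS vS]]]]].
have vsrc (g : edge suppress) : val (src g) = src (val g).
  rewrite /= val_insubd ifT //; have [->//|ge] := eqVneq (val g) e.
  by have [] := other ge (valP g).
have vtgt (g : edge suppress) : val (tgt g) = tgt (if val g == e then f else val g).
  rewrite /= val_insubd ifT //; have [//|ge] := eqVneq (val g) e.
  by have [] := other ge (valP g).
have lE : \sum_g suppress_length g = \sum_g l g.
  rewrite -(big_sub (predC1 f) (fun g => if g == e then (l e + l f)%N else l g)).
  rewrite [RHS](bigD1 f) //= (bigD1 e) //= [in RHS](bigD1 e ef) /= eqxx.
  rewrite [RHS]addnA [in RHS](addnC (l f)); congr addn.
  by apply: eq_bigr => g /andP[_ /negbTE->].
split=> [g|||]; rewrite ?lE //.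
- by rewrite /suppress_length; case: ifP => // _; rewrite addn_gt0 l0.
- have -> : #|vert suppress| = #|vert K|.-1 by rewrite /= card_sig -(cardC1 v).
  have -> : #|edge suppress| = #|edge K|.-1 by rewrite /= card_sig -(cardC1 f).
  have : (0 < #|vert K|)%N by apply/card_gt0P; exists v.
  have : (0 < #|edge K|)%N by apply/card_gt0P; exists f.
  by move: cV; lia.
exists (b \o val).
exists (fun g k => if (val g == e) && (l e < k)%N then c f (k - l e)%N else c (val g) k).
exists (fun g k => if (val g == e) && (l e <= k)%N then d f (k - l e)%N else d (val g) k).
have cev : c e (l e) = c f 0 by have [_ ->] := cb e; have [-> _] := cb f; rewrite te sf.
split.
- move=> g; split.
    by rewrite ltn0 andbF [RHS](congr1 b (vsrc g)); have [] := cb (val g).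
  rewrite [RHS](congr1 b (vtgt g)) /suppress_length.
  case: eqP => /= _; last by have [] := cb (val g).
  by rewrite -[X in (X < _)%N]addn0 ltn_add2l l0 addKn; have [] := cb f.
- move=> g k; rewrite /suppress_length; case: eqP => /= [->|_]; last exact: dE.
  have [ke|ek] := ltnP k (l e) => [_|kl].
    by rewrite [(l e < k.+1)%N]ltnS [(l e < k)%N]leqNgt ltnS (ltnW ke) leqNgt ke dE.
  rewrite ltnS ek subSn // dE; last by lia.
  case: ifP => // /negbT; rewrite -leqNgt => ke.
  by have <- : l e = k; [apply/eqP; rewrite eqn_leq ek | rewrite subnn cev].
- move=> a; have [g [k [kl <-]]] := dS a.
  have [gf|gf] := eqVneq g f.
    exists (exist _ e ef), (l e + k)%N; rewrite /suppress_length /= eqxx leq_addr addKn gf.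
    by rewrite ltn_add2l -gf.
  exists (exist _ g gf), k; rewrite /suppress_length /=.
  case: eqP kl => //= -> kl; rewrite [(l e <= k)%N]leqNgt kl; split=> //.
  exact: ltn_addr.
move=> w; have [[x <-]|[g [k [/andP[k0 kl] <-]]]] := vS w.
  have [xv|xv] := eqVneq x v; last by left; exists (exist _ x xv).
  right; exists (exist _ e ef), (l e); rewrite /suppress_length /= eqxx ltnn l0.
  rewrite -[X in (X < _)%N]addn0 ltn_add2l l0; split=> //.
  by have [_ ->] := cb e; rewrite te xv.
right; have [gf|gf] := eqVneq g f.
  exists (exist _ e ef), (l e + k)%N; rewrite /suppress_length /= eqxx addKn gf.
  have -> : (l e < l e + k)%N by rewrite -addn1 leq_add2l.
  by rewrite ltn_add2l -gf addn_gt0 k0 orbT.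
exists (exist _ g gf), k; rewrite /suppress_length /= k0.
case: eqP kl => //= -> kl; rewrite [(l e < k)%N]ltnNge (ltnW kl) /=; split=> //.
exact: ltn_addr.
Qed.

End Suppress.

(** The edges [e] and [f] may be parallel, in which case suppression creates a loop. *)
Definition suppressible K (v : vert K) : Prop :=
  exists e f : edge K, [/\ e != f, forall g, (v \in ends g) = (g == e) || (g == f),
    src e != tgt e & src f != tgt f].

Lemma suppressible_decomposition K (l : edge K -> nat) (v : vert K) :
  suppressible v -> chain_decomposition H l ->
  exists K' (l' : edge K' -> nat),
    chain_decomposition H l' /\ (#|vert K'| < #|vert K|)%N.
Proof.
move=> [e [f [ef inc le lf]]] D.
(* Reorients [e] and [f] so that [e] enters [v] and [f] leaves it. *)
pose flip g := ((g == e) && (tgt e != v)) || ((g == f) && (src f != v)).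
pose K1 := @MGraph (vert K) (edge K)
  (fun g => if flip g then tgt g else src g) (fun g => if flip g then src g else tgt g).
have {}D : @chain_decomposition H K1 l.
  apply: (@chain_decomposition_iso K K1 l id id) D => [||g]; [by exists id|by exists id|].
  by rewrite imset_id /ends /=; case: ifP => // _; rewrite setUC.
have ve : v \in ends e by rewrite inc eqxx.
have vf : v \in ends f by rewrite inc eqxx orbT.
have te : @tgt K1 e = v.
  rewrite /= /flip eqxx (negbTE ef) /= orbF; case: eqP => //= /eqP te.
  by move: ve; rewrite !inE [v == tgt e]eq_sym (negbTE te) orbF => /eqP.
have sf : @src K1 f = v.
  rewrite /= /flip eqxx [f == e]eq_sym (negbTE ef) /=; case: eqP => //= /eqP sf.
  by move: vf; rewrite !inE [v == src f]eq_sym (negbTE sf) => /eqP.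
have se : @src K1 e != v.
  by rewrite -[X in _ != X]te /=; case: ifP => // _; rewrite eq_sym.
have tf : @tgt K1 f != v.
  by rewrite -[X in _ != X]sf /=; case: ifP => // _; rewrite eq_sym.
have oth g : g != e -> g != f -> @src K1 g != v /\ @tgt K1 g != v.
  move=> ge gf; have : v \notin ends g by rewrite inc negb_or ge.
  rewrite !inE negb_or /= [v == _]eq_sym [v == tgt g]eq_sym => /andP[? ?].
  by case: ifP.
exists (@suppress K1 v e f se), (@suppress_length K1 l v e f se).
split; first exact: (@suppress_chain_decomposition K1 l v e f ef te sf se tf oth D).
by rewrite card_sig -[X in (X < _)%N]/#|predC1 v| cardC1 prednK //; apply/card_gt0P; exists v.
Qed.

Lemma reduced_decomposition :
  exists K (l : edge K -> nat), chain_decomposition H l /\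
    forall v : vert K, ~ suppressible v.
Proof.
suff: forall n K (l : edge K -> nat), (#|vert K| < n)%N -> chain_decomposition H l ->
    exists K (l : edge K -> nat), chain_decomposition H l /\
      forall v : vert K, ~ suppressible v.
  by move=> /(_ _ _ _ (ltnSn _) chain_decomposition_refl).
elim=> // n IHn K l Kn D.
have [[v sv]|nsv] := pselect (exists v : vert K, suppressible v).
  have [K' [l' [D' K'K]]] := suppressible_decomposition sv D.
  by apply: IHn D'; apply: leq_trans K'K _.
by exists K, l; split=> // v sv; apply: nsv; exists v.
Qed.

End ChainDecomposition.

(** * Graphs with the maximal c_2 *)

Lemma sum_eq_const (I : finType) (F : I -> nat) c :
  (forall i, c <= F i)%N -> (\sum_i F i <= #|I| * c)%N -> forall i, F i = c.
Proof.
move=> Fc sF; have := @leqif_sum I xpredT (fun i => c == F i) (fun=> c) F.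
move=> /(_ (fun i _ => leqif_eq (Fc i))) [_ E].
move: E; rewrite sum_nat_const eqn_leq sF andbT.
rewrite -(sum_nat_const I c) leq_sum // => /esym/forallP h i.
by have := h i; rewrite /= => /eqP.
Qed.

Lemma sum_ge_const (I : finType) (F : I -> nat) c :
  (forall i, F i <= c)%N -> (#|I| * c <= \sum_i F i)%N -> forall i, F i = c.
Proof.
move=> Fc sF; have := @leqif_sum I xpredT (fun i => F i == c) F (fun=> c).
move=> /(_ (fun i _ => leqif_eq (Fc i))) [h E].
move: E; rewrite eqn_leq h sum_nat_const sF => /esym/forallP h' i.
by have := h' i; rewrite /= => /eqP.
Qed.

Section PairSum.
Variables (E : finType) (l : E -> nat).

Lemma sum_set1 (P : pred {set E}) :
  \sum_(X : {set E} | (#|X| == 1%N) && P X) \prod_(e in X) l e = \sum_(e | P [set e]) l e.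
Proof.
transitivity (\sum_(X in [set [set e] | e in [set e | P [set e]]]) \prod_(e in X) l e).
  apply: eq_bigl => X; apply/andP/imsetP => [[/cards1P[e ->] Pe]|[e]].
    by exists e; rewrite ?inE.
  by rewrite inE => Pe ->; rewrite cards1.
rewrite big_imset /=; last by move=> x y _ _; apply: set1_inj.
apply: eq_big => [e|e _]; [by rewrite inE | by rewrite big_set1].
Qed.

(** In the square of the sum the diagonal gives the squares, and each 2-set arises from two ordered
    pairs. *)
Lemma sum_set2 :
  ((\sum_(X : {set E} | #|X| == 2%N) \prod_(e in X) l e) * 2 + \sum_e l e * l e)%N =
  ((\sum_e l e) * (\sum_e l e))%N.
Proof.
rewrite big_distrlr /= pair_big /=.
rewrite [RHS](bigID (fun p : E * E => p.1 == p.2)) /= addnC; congr addn.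
  rewrite -(pair_big_dep xpredT (fun i j => i == j) (fun i j => l i * l j)%N) /=.
  by apply: eq_bigr => e _; rewrite (big_pred1 e) // => f; rewrite eq_sym.
rewrite [RHS](partition_big (fun p : E * E => [set p.1; p.2]) (fun X => #|X| == 2%N)) /=; last first.
  by move=> [e f] /= ef; rewrite cards2 ef.
rewrite big_distrl; apply: eq_bigr => X /cards2P[a [b [ab ->]]].
rewrite big_setU1 ?inE //= big_set1.
rewrite (eq_bigl (mem [set (a, b); (b, a)])).
  rewrite big_setU1 ?big_set1 /= ?inE ?xpair_eqE ?negb_and ?ab //.
  by rewrite [(l b * l a)%N]mulnC muln2 addnn.
move=> [e f]; rewrite !inE !xpair_eqE /=; apply/andP/orP => [[ef /eqP S]|].
  have /set2P[ea|ea] : e \in [set a; b] by rewrite -S !inE eqxx.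
    have /set2P[fb|fb] : f \in [set a; b] by rewrite -S !inE eqxx orbT.
      by rewrite ea fb eqxx in ef.
    by left; rewrite ea fb !eqxx.
  have /set2P[fb|fb] : f \in [set a; b] by rewrite -S !inE eqxx orbT.
    by right; rewrite ea fb !eqxx.
  by rewrite ea fb eqxx in ef.
by case=> /andP[/eqP-> /eqP->]; rewrite ?ab ?[b == a]eq_sym ?ab ?eqxx // setUC eqxx.
Qed.

End PairSum.

Section Incidence.
Variable K : mgraph.

Definition incident (v : vert K) : {set edge K} := [set e | v \in ends e].

Lemma sum_incident : \sum_v #|incident v| = \sum_(e : edge K) #|ends e|.
Proof.
under eq_bigr do rewrite -sum1_card.
under [RHS]eq_bigr do rewrite -sum1_card.
rewrite (exchange_big_dep xpredT) //=; apply: eq_bigr => e _.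
by apply: eq_bigl => v; rewrite inE.
Qed.

Lemma crossing_edge (A : {set edge K}) (u v : vert K) :
  spanning_connected A -> u != v ->
  exists e, [/\ e \in A, e \in incident v & src e != tgt e].
Proof.
move=> cA uv.
have [e /and3P[eA ev es]|none] :=
  pickP [pred e | [&& e \in A, e \in incident v & src e != tgt e]]; first by exists e.
suff: ~~ spanning_connected A by rewrite cA.
apply: (@cut_not_connected K A (pred1 v) v u); rewrite ?inE //= => e eA.
have := none e; rewrite /= eA !inE /= [v == _]eq_sym [v == tgt e]eq_sym.
case: (eqVneq (src e) v) => sv; case: (eqVneq (tgt e) v) => tv //=.
  by rewrite sv eq_sym tv.
by rewrite tv sv.
Qed.

(** A non-loop edge leaves [v] by connectivity, and a second one because the first is no bridge;
    were these all, [v] would be suppressible. *)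
Lemma incident_ge3 (v : vert K) :
  (1 < #|vert K|)%N -> (forall e : edge K, spanning_connected (~: [set e])) ->
  connected K -> ~ suppressible v -> (3 <= #|incident v|)%N.
Proof.
move=> K1 br cK ns; rewrite ltnNge; apply/negP => i2.
have [u uv] : exists u, u != v.
  have /card_gt0P[u] : (0 < #|predC1 v|)%N by rewrite cardC1 -subn1 subn_gt0.
  by exists u.
have [e [_ ev el]] := crossing_edge cK uv.
have [f [fe fv fl]] := crossing_edge (br e) uv.
apply: ns; exists e, f.
have ef : e != f by rewrite eq_sym; move: fe; rewrite !inE.
have I2 : [set e; f] = incident v.
  apply/eqP; rewrite eqEcard cards2 ef i2 andbT; apply/subsetP => g.
  by rewrite !inE => /orP[]/eqP->; [move: ev | move: fv]; rewrite !inE.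
by split=> // g; move/setP/(_ g): I2; rewrite !inE => <-.
Qed.

Definition cubic_simple : Prop :=
  [/\ #|vert K| = 8, #|edge K| = 12, forall v, #|incident v| = 3,
      forall e : edge K, src e != tgt e & injective (@ends K)].

(** There are at least 3 incidences at each of 8 vertices and at most 2 on each of 12 edges, so both
    bounds are attained everywhere: three edges per vertex and no loops. If two edges were parallel,
    deleting the at most two other edges at their ends would cut these ends off. *)
Lemma cubic_simple_of_connectivity : #|vert K| = 8 -> #|edge K| = 12 ->
  connected K -> (forall v, ~ @suppressible K v) ->
  (forall X : {set edge K}, (#|X| <= 2)%N -> spanning_connected (~: X)) ->
  cubic_simple.
Proof.
move=> n8 m12 cK ns c3.
have e2 (e : edge K) : (#|ends e| <= 2)%N by rewrite cards2; case: (_ != _).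
have i3 v : (3 <= #|incident v|)%N.
  by apply: incident_ge3 => // [|e]; [rewrite n8 | apply: c3; rewrite cards1].
have i3E : forall v, #|incident v| = 3.
  apply: sum_eq_const => //; rewrite sum_incident n8.
  have : (\sum_(e : edge K) #|ends e| <= \sum_(e : edge K) 2)%N by apply: leq_sum.
  by rewrite sum_nat_const m12.
have e2E : forall e : edge K, #|ends e| = 2.
  apply: sum_ge_const => //; rewrite -sum_incident m12.
  by rewrite (eq_bigr (fun=> 3)) // sum_nat_const n8.
have nl (e : edge K) : src e != tgt e by have := e2E e; rewrite cards2; case: (_ != _).
split=> // e g eg; apply/eqP/negPn/negP => ng.
set x := src e; set y := tgt e.
pose X := (incident x :\: [set e; g]) :|: (incident y :\: [set e; g]).
have iD v : v \in ends e -> (#|incident v :\: [set e; g]| <= 1)%N.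
  move=> ve; rewrite cardsD (_ : _ :&: _ = [set e; g]) ?cards2 ?ng ?i3E //.
  apply/setIidPr/subsetP => h; rewrite !inE => /orP[]/eqP->; first by move: ve; rewrite !inE.
  by move: ve; rewrite eg !inE.
have X2 : (#|X| <= 2)%N.
  apply: leq_trans (leq_card_setU _ _) _; rewrite -[2%N]/(1 + 1)%N.
  by rewrite leq_add // iD // !inE eqxx ?orbT.
have [z zxy] : exists z, z \notin [set x; y].
  apply/existsP; apply: contraT; rewrite negb_exists => /forallP zxy.
  have : (#|vert K| <= #|[set x; y]|)%N.
    by apply/subset_leq_card/subsetP => z _; have := zxy z; rewrite negbK.
  by rewrite n8 cards2; case: (_ != _).
have := c3 _ X2; apply/negP.
apply: (@cut_not_connected K _ (mem [set x; y]) x z); rewrite //= ?inE ?eqxx //.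
move=> h; rewrite inE => hX.
have [hx|hx] := boolP (h \in [set e; g]).
  have E : ends h = [set x; y] by case/set2P: hx => ->; rewrite // -eg.
  by rewrite -E !inE !eqxx orbT.
have hxi : h \notin incident x by apply: contra hX => hi; rewrite inE in_setD hx hi.
have hyi : h \notin incident y.
  by apply: contra hX => hi; rewrite inE [X in _ || X]in_setD hx hi orbT.
move: hxi hyi; rewrite !inE !negb_or ![x == _]eq_sym ![y == _]eq_sym.
by move=> /andP[/negbTE-> /negbTE->] /andP[/negbTE-> /negbTE->].
Qed.

End Incidence.

Lemma weighted_deletions0 K (l : edge K -> nat) : weighted_deletions l 0 = connected K.
Proof.
rewrite /weighted_deletions (eq_bigl (fun X => (X == set0) && connected K)); last first.
  by move=> X; rewrite cards_eq0; case: eqP => // ->; rewrite setC0.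
case: (connected K); last by rewrite big_pred0 // => X; rewrite andbF.
by rewrite (big_pred1 set0) ?big_set0 // => X; rewrite andbT.
Qed.

Lemma nb_deletions_weighted G j : nb_deletions G j = weighted_deletions (fun _ : edge G => 1%N) j.
Proof.
rewrite /nb_deletions /weighted_deletions -sum1_card.
by apply: eq_big => [X|X _]; [rewrite inE | rewrite big1].
Qed.

Lemma weighted_deletions_cst K q j :
  weighted_deletions (fun _ : edge K => q) j = (nb_deletions K j * q ^ j)%N.
Proof.
rewrite /nb_deletions -sum_nat_const /weighted_deletions.
by apply: eq_big => [X|X /andP[/eqP<- _]]; rewrite ?inE // prod_nat_const.
Qed.

Section WeightedBounds.
Variables (K : mgraph) (l : edge K -> nat).
Hypothesis l_gt0 : forall e, (0 < l e)%N.

Lemma weighted_deletions1_le : (weighted_deletions l 1 <= \sum_e l e)%N.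
Proof.
rewrite /weighted_deletions sum_set1.
by rewrite [leqRHS](bigID (fun e : edge K => spanning_connected (~: [set e]))) leq_addr.
Qed.

Lemma weighted_deletions1_eq : weighted_deletions l 1 = \sum_e l e ->
  forall e : edge K, spanning_connected (~: [set e]).
Proof.
rewrite /weighted_deletions sum_set1.
rewrite [RHS](bigID (fun e : edge K => spanning_connected (~: [set e]))) /=.
move=> /eqP; rewrite -[X in X == _]addn0 eqn_add2l eq_sym sum_nat_eq0 => /forallP h e.
by have := h e; rewrite eqn0Ngt l_gt0 implybF negbK.
Qed.

Lemma weighted_deletions2_le :
  (weighted_deletions l 2 <= \sum_(X : {set edge K} | #|X| == 2%N) \prod_(e in X) l e)%N.
Proof.
rewrite /weighted_deletions.
by rewrite [leqRHS](bigID (fun X : {set edge K} => spanning_connected (~: X))) leq_addr.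
Qed.

Lemma weighted_deletions2_eq :
  weighted_deletions l 2 = \sum_(X : {set edge K} | #|X| == 2%N) \prod_(e in X) l e ->
  forall X : {set edge K}, #|X| = 2%N -> spanning_connected (~: X).
Proof.
rewrite [RHS](bigID (fun X : {set edge K} => spanning_connected (~: X))) /=.
move=> /eqP; rewrite -[X in X == _]addn0 eqn_add2l eq_sym sum_nat_eq0 => /forallP h X /eqP X2.
have := h X; rewrite X2 /= eqn0Ngt prodn_gt0 // implybF negbK; exact.
Qed.

End WeightedBounds.

Section Extremal.
Variables (H : mgraph) (q : nat).
Hypotheses (q0 : (0 < q)%N) (cH : connected H).
Hypotheses (vH : #|vert H| = (12 * q - 4)%N) (eH : #|edge H| = (12 * q)%N).

Lemma nb_deletions1_le : (nb_deletions H 1 <= 12 * q)%N.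
Proof. by rewrite nb_deletions_weighted -eH -sum1_card weighted_deletions1_le. Qed.

Hypothesis brH : nb_deletions H 1 = (12 * q)%N.

(** Suppression preserves |E| - |V| = 4. With two or more vertices, three edges at each give 3|V| <=
    2|E|, hence |V| <= 8. *)
Lemma reduced_few_edges (K : mgraph) (l : edge K -> nat) :
  chain_decomposition H l -> (forall v, ~ @suppressible K v) ->
  [/\ connected K, (forall e : edge K, spanning_connected (~: [set e])),
      #|edge K| = (#|vert K| + 4)%N & (#|edge K| <= 12)%N].
Proof.
move=> D ns; have [l0 cV cE _] := D; have I := chain_decomposition_isomorphic D.
have wE j : nb_deletions H j = weighted_deletions l j.
  by rewrite (isomorphic_nb_deletions j I) nb_deletions_subdivide.
have cK : connected K.
  have : (connected K : nat) = 1%N.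
    by rewrite -(weighted_deletions0 l) -wE nb_deletions_weighted weighted_deletions0 cH.
  by case: (connected K).
have br : forall e : edge K, spanning_connected (~: [set e]).
  by apply: (weighted_deletions1_eq l0); rewrite -wE brH cE.
have EV : #|edge K| = (#|vert K| + 4)%N by move: cV; rewrite vH eH; lia.
split=> //; have [n1|n2] := leqP #|vert K| 1; first by rewrite EV; lia.
have : (#|vert K| * 3 <= #|edge K| * 2)%N; last by lia.
rewrite -!sum_nat_const; apply: (@leq_trans (\sum_v #|@incident K v|)).
  by apply: leq_sum => v _; apply: incident_ge3.
by rewrite sum_incident; apply: leq_sum => e _; rewrite cards2; case: (_ != _).
Qed.

(** Let S be the sum of the products of two lengths and Q the sum of their squares. Then 2 S + Q =
    144 q^2, and summing 2 l q <= l^2 + q^2 over at most 12 edges gives Q >= 12 q^2, so S <= 66 q^2.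
    Equality needs 12 chains of length q and all deletions of two edges to leave [K] connected. *)
Lemma nb_deletions2_extremal :
  (nb_deletions H 2 <= 66 * q ^ 2)%N /\
  (nb_deletions H 2 = (66 * q ^ 2)%N -> exists2 K,
     chain_decomposition H (fun _ : edge K => q) & cubic_simple K).
Proof.
have [K [l [D ns]]] := reduced_decomposition H.
have [cK br EV E12] := reduced_few_edges D ns.
have [l0 cV cE _] := D; have I := chain_decomposition_isomorphic D.
have wE j : nb_deletions H j = weighted_deletions l j.
  by rewrite (isomorphic_nb_deletions j I) nb_deletions_subdivide.
have S2 := sum_set2 l; have W2 := weighted_deletions2_le l.
have agm : (\sum_e 2 * (l e * q) <= \sum_e (l e * l e + q ^ 2) ?= iff [forall e, l e == q])%N.
  by apply: leqif_sum => e _; have := nat_Cauchy (l e) q; rewrite -[X in (_ <= X + _ ?= iff _)%N]mulnn.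
have A1 : (\sum_e 2 * (l e * q) = 2 * (12 * q * q))%N.
  by rewrite -big_distrr -big_distrl /= cE eH.
have A2 : (\sum_e (l e * l e + q ^ 2) = \sum_e l e * l e + #|edge K| * (q * q))%N.
  by rewrite [LHS]big_split /= sum_nat_const mulnn.
rewrite {}A1 {}A2 in agm; rewrite cE eH in S2.
rewrite wE; set S := \sum_(X : {set _} | _) _ in S2 W2; set Q := \sum_e _ in S2 agm.
set t := #|edge K| in E12 EV agm.
have [agm1 agm2] := agm.
have qq : (0 < q * q)%N by rewrite muln_gt0 q0.
have tq : (t * (q * q) <= 12 * (q * q))%N by rewrite leq_mul2r E12 orbT.
have S132 : (S <= 66 * (q * q))%N by lia.
rewrite -!mulnn; split=> [|W66]; first by lia.
have SW : S = weighted_deletions l 2 by lia.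
have t12 : t = 12.
  apply/eqP; rewrite eqn_leq E12 -(leq_pmul2r qq); lia.
have lq e : l e = q.
  have : [forall e, l e == q] by rewrite -agm2; apply/eqP; rewrite t12; lia.
  by move/forallP/(_ e)/eqP.
exists K; first by rewrite -(funext lq).
apply: cubic_simple_of_connectivity => //; first by move: EV; rewrite t12; lia.
move=> X; rewrite leq_eqVlt => /predU1P[X2|].
  exact: weighted_deletions2_eq l0 (esym SW) _ X2.
rewrite ltnS leq_eqVlt => /predU1P[/eqP/cards1P[e ->] //|].
by rewrite ltnS leqn0 cards_eq0 => /eqP->; rewrite setC0.
Qed.

End Extremal.

(** * Cubic graphs on 8 vertices *)

Definition merge_labels (u v : nat) (lab : seq nat) : seq nat :=
  let a := nth 0%N lab u in let b := nth 0%N lab v in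
  [seq if x == a then b else x | x <- lab].

Section DeletionSum.
Variables (A T : Type) (zero one : T) (add : T -> T -> T) (scale : A -> T -> T).

(* Each edge [(u, v, a)] in turn is either deleted, with weight [a], or        *)
(* contracted; [lab] records the components formed by the contracted edges.    *)
Fixpoint deletion_sum (es : seq (nat * nat * A)) (j : nat) (lab : seq nat) : T :=
  match es with
  | [::] => if (j == 0) && constant lab then one else zero
  | (u, v, a) :: es' =>
      let keep := deletion_sum es' j (merge_labels u v lab) in
      if j is j'.+1 then add (scale a (deletion_sum es' j' lab)) keep else keep
  end.

Variables (h : T -> nat) (w : A -> nat).
Hypotheses (h0 : h zero = 0%N) (h1 : h one = 1%N).
Hypothesis hD : forall s t, h (add s t) = (h s + h t)%N.
Hypothesis hZ : forall a t, h (scale a t) = (w a * h t)%N.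

Variables (K : mgraph) (n : nat) (nu : vert K -> 'I_n) (a : edge K -> A).
Hypothesis nu_bij : bijective nu.

Definition labels_components (lab : seq nat) (B : {set edge K}) : Prop :=
  size lab = n /\ forall x y,
    (nth 0%N lab (nu x) == nth 0%N lab (nu y)) = connect (adj B) x y.

Lemma labels_components0 : labels_components (iota 0 n) set0.
Proof.
split=> [|x y]; first by rewrite size_iota.
rewrite !nth_iota // !add0n val_eqE (bij_eq nu_bij).
apply/eqP/connectP => [->|[[|z p] /= P ->] //]; first by exists [::].
by case/andP: P => /existsP[e]; rewrite inE.
Qed.

Lemma labels_components_merge lab B e : labels_components lab B ->
  labels_components (merge_labels (nu (src e)) (nu (tgt e)) lab) (e |: B).
Proof.
move=> [sz L]; split=> [|x y]; first by rewrite size_map.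
rewrite !(nth_map 0%N) ?sz // connect_setU1 -!L.
set s := nth _ _ (nu (src e)); set t := nth _ _ (nu (tgt e)).
set i := nth _ _ _; set j := nth _ _ _.
by move: i j s t => i j s t; case: (eqVneq i s) => si; case: (eqVneq j s) => sj; lia.
Qed.

Lemma labels_components_constant lab B : (0 < n)%N ->
  labels_components lab B -> constant lab = spanning_connected B.
Proof.
move=> n0 [sz L]; have [nu' nuK nu'K] := nu_bij.
have x0 := nu' (Ordinal n0).
apply/idP/spanning_connectedP => [/(constantP 0%N)[x Ex]|[_ C]].
  split=> [|y z]; first by exists x0.
  by rewrite -L Ex !nth_nseq sz !ltn_ord.
apply/(constantP 0%N); exists (nth 0%N lab (nu x0)).
apply: (@eq_from_nth _ 0%N) => [|i]; rewrite ?size_nseq // => il.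
rewrite nth_nseq il; rewrite sz in il; apply/eqP.
by rewrite -[i]/(val (Ordinal il)) -(nu'K (Ordinal il)) L.
Qed.

(** [B] is the set of edges contracted so far and [lab] records its components; the sets [X] split
    according to whether they contain the next edge. The interpretation [h] lets one recursion serve
    for plain counts and for polynomials. *)
Lemma deletion_sumE es j lab B : (0 < n)%N -> uniq es -> labels_components lab B ->
  h (deletion_sum [seq (val (nu (src e)), val (nu (tgt e)), a e) | e <- es] j lab) =
  \sum_(X : {set edge K} | [&& X \subset es, #|X| == j &
          spanning_connected (B :|: ([set e in es] :\: X))])
     \prod_(e in X) w (a e).
Proof.
move=> n0; elim: es j lab B => [|e es IHes] j lab B /=.
  move=> _ LB; rewrite (labels_components_constant n0 LB).
  have E (X : {set edge K}) : (X \subset [::]) = (X == set0).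
    by rewrite -subset0; apply: eq_subset_r => x; rewrite inE.
  case: ifP => [/andP[/eqP-> cB]|F].
    rewrite h1 (big_pred1 set0) ?big_set0 // => X; rewrite E /=.
    by case: eqP => // ->; rewrite cards0 setD0 set_nil setU0 cB.
  rewrite h0 big_pred0 // => X; rewrite E; case: eqP => //= ->.
  by rewrite cards0 setD0 set_nil setU0 eq_sym.
move=> /andP[ees Ues] LB; rewrite (bigID (fun X : {set edge K} => e \in X)) /=.
have keep : h (deletion_sum
      [seq (val (nu (src e0)), val (nu (tgt e0)), a e0) | e0 <- es] j
      (merge_labels (nu (src e)) (nu (tgt e)) lab)) =
   \sum_(X : {set edge K} | [&& X \subset e :: es, #|X| == j &
          spanning_connected (B :|: ([set e0 in e :: es] :\: X))] && (e \notin X))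
     \prod_(e in X) w (a e).
  rewrite (IHes _ _ _ Ues (labels_components_merge e LB)); apply: eq_bigl => X.
  rewrite [RHS]andbC; case: (boolP (e \in X)) => eX /=.
    by apply/negP => /andP[/subsetP/(_ e eX)]; rewrite (negbTE ees).
  have -> : (X \subset e :: es) = (X \subset es).
    apply/subsetP/subsetP => sX x xX; last by rewrite inE sX ?orbT.
    by have := sX x xX; rewrite inE => /predU1P[xe|//]; rewrite -xe xX in eX.
  suff -> : e |: B :|: [set e0 in es] :\: X = B :|: [set e0 in e :: es] :\: X by [].
  apply/setP => x; rewrite !inE; case: (eqVneq x e) => [->|] //=.
  by rewrite eX orbT.
have drop i : \sum_(X : {set edge K} | [&& X \subset e :: es, #|X| == i &
          spanning_connected (B :|: ([set e0 in e :: es] :\: X))] && (e \in X))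
     \prod_(e in X) w (a e) = if i is i'.+1 then (w (a e) * h (deletion_sum
      [seq (val (nu (src e0)), val (nu (tgt e0)), a e0) | e0 <- es] i' lab))%N else 0%N.
  case: i => [|i].
    rewrite big_pred0 // => X; case: (boolP (e \in X)) => [eX|]; last by rewrite andbF.
    by rewrite (cardsD1 e) eX /= andbF.
  rewrite (IHes _ _ _ Ues LB) big_distrr /=.
  rewrite (reindex_onto (fun Y => e |: Y) (fun X => X :\ e)) /=; last first.
    by move=> X /andP[_ eX]; rewrite setD1K.
  have E (Y : {set edge K}) : ((e |: Y) :\ e == Y) = (e \notin Y).
    apply/eqP/idP => [<-|eY]; first by rewrite !inE eqxx.
    by rewrite setU1K.
  apply: eq_big => [Y|Y /andP[/andP[_ _]]]; last by rewrite E => eY; rewrite big_setU1.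
  rewrite E; case: (boolP (e \in Y)) => eY; rewrite ?andbF ?andbT /=.
    by apply/esym/negP => /andP[/subsetP/(_ e eY)]; rewrite (negbTE ees).
  rewrite setU11 andbT cardsU1 eY add1n eqSS.
  have -> : (e |: Y \subset e :: es) = (Y \subset es).
    apply/subsetP/subsetP => sX x xX; last first.
      by move: xX; rewrite !inE => /orP[->//|/sX->]; rewrite orbT.
    have := sX x; rewrite !inE xX orbT => /(_ isT)/predU1P[xe|//].
    by rewrite -xe xX in eY.
  suff -> : B :|: [set e0 in e :: es] :\: (e |: Y) = B :|: [set e0 in es] :\: Y by [].
  apply/setP => x; rewrite !inE; case: (eqVneq x e) => [->|] //=.
  by rewrite (negbTE ees) andbF.
by case: j keep => [|j] keep; rewrite drop ?hD ?hZ keep.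
Qed.

Lemma weighted_deletions_sum es j : (0 < n)%N -> uniq es -> (forall e, e \in es) ->
  weighted_deletions (w \o a) j =
  h (deletion_sum [seq (val (nu (src e)), val (nu (tgt e)), a e) | e <- es] j (iota 0 n)).
Proof.
move=> n0 Ues Aes; rewrite (deletion_sumE j n0 Ues labels_components0).
apply: eq_bigl => X; rewrite set0U (_ : X \subset es) /=; last exact/subsetP.
suff -> : [set e in es] :\: X = ~: X by [].
by apply/setP => e; rewrite !inE Aes andbT.
Qed.

End DeletionSum.

(** * Enumeration of the cubic graphs *)

Definition count_deletions (s : seq (nat * nat)) (j : nat) : nat :=
  deletion_sum 0%N 1%N addn (fun (_ : unit) c => c) [seq (p.1, p.2, tt) | p <- s] j (iota 0 8).

Definition wagner_edges : seq (nat * nat) :=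
  [:: (0,1); (1,2); (2,3); (3,4); (4,5); (5,6); (6,7); (7,0); (0,4); (1,5); (2,6); (3,7)]%N.

(** The possible neighbourhoods of a vertex with residual degree [r] among later vertices with
    residual degrees [ds]. *)
Fixpoint choose_row (ds : seq nat) (r : nat) : seq bitseq :=
  if ds is d :: ds' then
    (if (0 < d)%N && (0 < r)%N then [seq true :: b | b <- choose_row ds' r.-1] else [::])
      ++ [seq false :: b | b <- choose_row ds' r]
  else if r == 0%N then [:: [::]] else [::].

Fixpoint sub_row (ds : seq nat) (b : bitseq) : seq nat :=
  match ds, b with
  | d :: ds', x :: b' => (if x then d.-1 else d) :: sub_row ds' b'
  | _, _ => [::]
  end.

(* The upper triangles, row by row and without the diagonal, of all adjacency  *)
(* matrices with degree sequence [ds].                                         *)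
Fixpoint graph_rows (n : nat) (ds : seq nat) : seq (seq bitseq) :=
  match n, ds with
  | n'.+1, r :: ds' =>
      flatten [seq [seq b :: t | t <- graph_rows n' (sub_row ds' b)] | b <- choose_row ds' r]
  | _, _ => [:: [::]]
  end.

Fixpoint edge_list (T : Type) (vs : seq T) (rows : seq bitseq) : seq (T * T) :=
  match vs, rows with
  | v :: vs', b :: rows' => [seq (v, u) | u <- mask b vs'] ++ edge_list vs' rows'
  | _, _ => [::]
  end.

Lemma edge_list_map (T U : Type) (f : T -> U) vs rows :
  edge_list (map f vs) rows = [seq (f p.1, f p.2) | p <- edge_list vs rows].
Proof.
elim: vs rows => [|v vs IHvs] [|b rows] //=.
by rewrite IHvs map_cat -map_mask -!map_comp.
Qed.

Section Rows.
Variables (T : eqType) (a : rel T).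
Hypotheses (a_sym : symmetric a) (a_irr : irreflexive a).

Fixpoint adj_rows (vs : seq T) : seq bitseq :=
  if vs is v :: vs' then map (a v) vs' :: adj_rows vs' else [::].

Lemma choose_row_map (d : T -> nat) v vs :
  (forall u, u \in vs -> a v u -> 0 < d u)%N ->
  map (a v) vs \in choose_row (map d vs) (count (a v) vs).
Proof.
elim: vs => [|u vs IHvs] //= d0; rewrite mem_cat.
have {IHvs} IH := IHvs (fun z zvs => d0 z (mem_behead (s := u :: vs) zvs)).
have := d0 u (mem_head _ _); case: (a v u) => [->//|_] /=.
  by rewrite add1n /= map_f.
by rewrite add0n [X in _ || X]map_f ?orbT.
Qed.

Lemma sub_row_map (d : T -> nat) v vs :
  sub_row (map d vs) (map (a v) vs) = [seq (d u - a v u)%N | u <- vs].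
Proof.
by elim: vs => //= u vs ->; case: (a v u); rewrite ?subn1 ?subn0.
Qed.

(** Completeness of the enumeration: [sub_row] leaves to each later vertex its degree among the
    later vertices. *)
Lemma adj_rows_in vs (ds := [seq count (a v) vs | v <- vs]) :
  adj_rows vs \in graph_rows (size vs) ds.
Proof.
rewrite {}/ds; elim: vs => [|v vs IHvs] //=; rewrite a_irr add0n.
apply/flatten_mapP; exists (map (a v) vs).
  by apply: choose_row_map => u _; rewrite a_sym => ->.
apply: map_f; rewrite sub_row_map; congr (_ \in graph_rows _ _): IHvs.
by apply: eq_map => u; rewrite a_sym addKn.
Qed.

Lemma edge_list_adj vs p : p \in edge_list vs (adj_rows vs) -> a p.1 p.2.
Proof.
elim: vs => [|v vs IHvs] //=; rewrite mem_cat => /orP[|/IHvs//].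
by rewrite -filter_mask => /mapP[u]; rewrite mem_filter => /andP[? _] ->.
Qed.

End Rows.

(** A certificate: numbering the vertices by [o] sends each edge of W to an edge in [s], and equal
    numbers of edges make this an isomorphism. *)
Definition wagner_order (s : seq (nat * nat)) (o : seq nat) : bool :=
  [&& size o == 8, uniq o, all (fun x => x < 8)%N o &
   all (fun p => let x := nth 0%N o p.1 in let y := nth 0%N o p.2 in
        ((x, y) \in s) || ((y, x) \in s)) wagner_edges].

(** Candidates for [wagner_order]: the rim of W is a Hamiltonian cycle. Paths are extended at the
    head. *)
Fixpoint hamiltonian_paths (s : seq (nat * nat)) (n : nat) (p : seq nat) : seq (seq nat) :=
  if n is n'.+1 then
    flatten [seq hamiltonian_paths s n' (v :: p)
            | v <- iota 0 8 & (v \notin p) &&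
               (((v, head 0%N p) \in s) || ((head 0%N p, v) \in s))]
  else [:: p].

(** Of the 220 triples of edges the 8 vertex stars always disconnect, so 212 is the largest possible
    c_3; 409 is c_4 of the Wagner graph. *)
Definition cubic_check (rows : seq bitseq) : bool :=
  let s := edge_list (iota 0 8) rows in
  [&& size s == 12, uniq s, all (fun p => p.1 < p.2 < 8)%N s &
    let c3 := count_deletions s 3 in
    if (c3 < 212)%N then true else
    if has (wagner_order s) (hamiltonian_paths s 7 [:: 0%N]) then true else
    (c3 == 212) && (count_deletions s 4 < 409)%N].

(* The vertices are labelled so that 1, 2, 3 are the neighbours of 0. *)
Definition first_row : bitseq := [:: true; true; true; false; false; false; false].

Lemma cubic_check_all :
  all (fun t => cubic_check (first_row :: t)) (graph_rows 7 [:: 2; 2; 2; 3; 3; 3; 3]).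
Proof. by vm_compute. Qed.

Lemma simple_graph_iso (G K : mgraph) (f : vert G -> vert K) :
  injective (@ends G) -> injective f ->
  #|vert G| = #|vert K| -> #|edge G| = #|edge K| ->
  (forall e, exists e', ends e' = f @: ends e) ->
  bijective f /\ exists2 g : edge G -> edge K, bijective g & forall e, ends (g e) = f @: ends e.
Proof.
move=> eI fI VV EE ex; split; first by apply: inj_card_bij; rewrite ?VV.
have ex' e : exists e', ends e' == f @: ends e by have [e' E] := ex e; exists e'; rewrite E.
exists (fun e => xchoose (ex' e)) => [|e]; last exact/eqP/(xchooseP (ex' e)).
apply: inj_card_bij; last by rewrite EE.
move=> e e' E; apply/eI/(imset_inj fI).
by rewrite -(eqP (xchooseP (ex' e))) E (eqP (xchooseP (ex' e'))).
Qed.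

Lemma map_in_const (T : eqType) (U : Type) (f : T -> U) c (s : seq T) :
  {in s, forall x, f x = c} -> map f s = nseq (size s) c.
Proof.
elim: s => //= x s IHs fc; rewrite fc ?mem_head // IHs // => y ys.
by rewrite fc // inE ys orbT.
Qed.

Definition list_graph (s : seq (nat * nat)) : mgraph :=
  @MGraph 'I_8 'I_(size s)
    (fun i => inord (nth (0, 0)%N s i).1) (fun i => inord (nth (0, 0)%N s i).2).

Section ListGraph.
Variable s : seq (nat * nat).
Hypothesis s_lt : all (fun p => p.1 < p.2 < 8)%N s.

Lemma list_graph_val (i : edge (list_graph s)) :
  [/\ (nth (0, 0)%N s i).1 < (nth (0, 0)%N s i).2,
      val (src i) = (nth (0, 0)%N s i).1 & val (tgt i) = (nth (0, 0)%N s i).2]%N.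
Proof.
have /(allP s_lt)/andP[lt12 lt8] : nth (0, 0)%N s i \in s by rewrite mem_nth.
by rewrite /= !inordK // (ltn_trans lt12).
Qed.

Lemma list_graph_ends_inj : uniq s -> injective (@ends (list_graph s)).
Proof.
move=> Us i j E; have [lti si ti] := list_graph_val i.
have [ltj sj tj] := list_graph_val j.
have : joins j (src i) (tgt i) by rewrite /joins -E.
case/joins_srctgtP => -[/(congr1 val) es /(congr1 val) et].
  apply/val_inj/eqP; rewrite -(nth_uniq (0, 0)%N _ _ Us) ?ltn_ord //.
  apply/eqP; rewrite [LHS]surjective_pairing [RHS]surjective_pairing.
  by rewrite -si -ti -sj -tj es et.
have lt : (val (src i) < val (tgt i))%N by rewrite si ti.
by rewrite es et sj tj ltnNge (ltnW ltj) in lt.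
Qed.

Lemma nb_deletions_list_graph j :
  nb_deletions (list_graph s) j = count_deletions s j.
Proof.
rewrite nb_deletions_weighted.
have := @weighted_deletions_sum unit nat 0%N 1%N addn (fun _ c => c) id (fun _ => 1%N)
  erefl erefl (fun _ _ => erefl) _ (list_graph s) 8 id (fun _ => tt) _
  (enum 'I_(size s)) j isT (enum_uniq _).
rewrite /weighted_deletions /= => ->; last 3 first.
- by move=> _ t; rewrite mul1n.
- by exists id.
- by move=> e; rewrite mem_enum.
congr deletion_sum.
transitivity [seq (p.1, p.2, tt) | p <- [seq nth (0, 0)%N s i | i <- iota 0 (size s)]].
  rewrite -val_enum_ord -!map_comp; apply: eq_map => i /=.
  by have [_ /= -> ->] := list_graph_val i.
by rewrite map_nth_iota0 // take_size.
Qed.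

End ListGraph.

Section CubicClassification.
Variable K : mgraph.
Hypothesis cubicK : cubic_simple K.
Local Notation a := (adj [set: edge K]).

Let K8 : #|vert K| = 8. Proof. by case: cubicK. Qed.

Lemma cubic_adj_irr : irreflexive a.
Proof.
move=> v; case: adjP => // -[e _ /joins_srctgtP J]; have [_ _ _ nl _] := cubicK.
by have := nl e; case: J => -[<- <-]; rewrite eqxx.
Qed.

Lemma cubic_neighbours v : #|[set u | a v u]| = 3.
Proof.
have [_ _ i3 nl eI] := cubicK; rewrite -(i3 v).
pose h e := if src e == v then tgt e else src e.
have hP e : e \in incident v -> ends e = [set v; h e].
  rewrite !inE /h => /orP[/eqP->|/eqP te]; first by rewrite eqxx.
  by have := nl e; rewrite -te => /negbTE->; rewrite /ends -te setUC.
rewrite -(card_in_imset (f := h) (D := mem (incident v))); last first.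
  by move=> e e' /hP E /hP E' hh; apply: eI; rewrite E E' hh.
apply: eq_card => u; rewrite !inE; apply/adjP/imsetP => [[e _ J]|[e /hP E ->]].
  have ev : e \in incident v by rewrite inE (eqP J) !inE eqxx.
  exists e => //; move: (eqP J); rewrite (hP e ev) => /setP/(_ u).
  rewrite !inE eqxx orbT => /orP[/eqP uv|/eqP//].
  have : a v v by apply/adjP; exists e; rewrite // -{2}uv.
  by rewrite cubic_adj_irr.
by exists e; rewrite // /joins E.
Qed.

(** Lists a vertex, its three neighbours, then the other four; without the first vertex exactly the
    neighbours lose a degree. *)
Lemma cubic_labelling : exists v0 vs, [/\ size vs = 7, uniq (v0 :: vs),
  (forall v, v \in v0 :: vs), map (a v0) vs = first_row &
  [seq count (a v) vs | v <- vs] = [:: 2; 2; 2; 3; 3; 3; 3]].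
Proof.
have /card_gt0P[v0 _] : (0 < #|vert K|)%N by rewrite K8.
pose N := [seq v <- enum (vert K) | a v0 v].
pose M := [seq v <- enum (vert K) | ~~ a v0 v && (v != v0)].
have U : uniq (v0 :: N ++ M).
  rewrite /= mem_cat !mem_filter cubic_adj_irr eqxx /= cat_uniq !filter_uniq -?enumT ?enum_uniq //=.
  by rewrite andbT; apply/hasPn => v; rewrite !mem_filter => /andP[/andP[/negbTE-> _]].
have mem v : v \in v0 :: N ++ M.
  rewrite inE mem_cat !(mem_filter _ _ (enum (vert K))) mem_enum !andbT.
  by case: eqP => //= _; case: (a v0 v).
have szN : size N = 3.
  by rewrite -(cubic_neighbours v0) cardsE cardE /enum_mem size_filter -enumT size_filter.
have P : perm_eq (v0 :: N ++ M) (enum (vert K)).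
  by apply: uniq_perm (U) (enum_uniq _) _ => v; rewrite mem mem_enum.
have sz8 : size (v0 :: N ++ M) = 8 by rewrite (perm_size P) -cardE K8.
have szM : size M = 4 by move: sz8; rewrite /= size_cat szN => -[].
have c3 v : count (a v) (v0 :: N ++ M) = 3.
  by rewrite -(cubic_neighbours v) cardsE cardE /enum_mem size_filter -enumT (permP P).
have aN : {in N, forall v, a v0 v = true} by move=> v; rewrite mem_filter => /andP[].
have aM : {in M, forall v, a v0 v = false}.
  by move=> v; rewrite mem_filter => /andP[/andP[/negbTE]].
exists v0, (N ++ M); split=> //; first by case: sz8.
  by rewrite map_cat (map_in_const aN) (map_in_const aM) szN szM.
have cN : {in N, forall v, count (a v) (N ++ M) = 2}.
  by move=> v /aN vN; have := c3 v; rewrite /= adj_sym vN => -[].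
have cM : {in M, forall v, count (a v) (N ++ M) = 3}.
  by move=> v /aM vM; have := c3 v; rewrite /= adj_sym vM.
by rewrite map_cat (map_in_const cN) (map_in_const cM) szN szM.
Qed.

End CubicClassification.

Lemma wagner_edge_mem (e : edge wagner) :
  (val (src e), val (tgt e)) \in wagner_edges.
Proof.
case: e => -[i i_lt] /=; first by do 8?[case: i i_lt => [|i] i_lt //].
by do 4?[case: i i_lt => [|i] i_lt //].
Qed.

Lemma wagner_ends_inj : injective (@ends wagner).
Proof.
move=> e e' E; have : joins e' (src e) (tgt e) by rewrite /joins -E.
case/joins_srctgtP => -[/(congr1 val) es /(congr1 val) et]; last first.
  have := wagner_edge_mem e; rewrite es et => m.
  have /allP/(_ _ (wagner_edge_mem e')) : all (fun p => (p.2, p.1) \notin wagner_edges) wagner_edges.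
    by [].
  by rewrite m.
case: e e' es et {E} => -[i i_lt] [] [j j_lt] /= es et.
- by congr inl; apply: val_inj.
- by exfalso; move: et j_lt; rewrite -es {es}; do 4?[case: i i_lt => [|i] i_lt //].
- by exfalso; move: et j_lt; rewrite -es {es}; do 4?[case: i i_lt => [|i] i_lt //].
- by congr inr; apply: val_inj.
Qed.

Lemma wagner_card : #|vert wagner| = 8 /\ #|edge wagner| = 12.
Proof. by rewrite card_sum !card_ord. Qed.

(** [K] is isomorphic to the [list_graph] of its labelled adjacency rows, which are among those
    covered by [cubic_check_all]. *)
Lemma cubic_classification K : cubic_simple K ->
  [\/ (nb_deletions K 3 < 212)%N,
      nb_deletions K 3 = 212 /\ (nb_deletions K 4 < 409)%N
    | exists (f : vert wagner -> vert K) (g : edge wagner -> edge K),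
        [/\ bijective f, bijective g & forall e, ends (g e) = f @: ends e]].
Proof.
move=> cubicK; have [K8 K12 _ _ _] := cubicK.
have a_irr := cubic_adj_irr cubicK; have a_sym := @adj_sym K setT.
have [v0 [vs [sz U mem row0 degs]]] := cubic_labelling cubicK.
set a := adj _ in a_irr a_sym row0 degs.
have : cubic_check (adj_rows a (v0 :: vs)).
  rewrite /= row0; apply: (allP cubic_check_all).
  by have := adj_rows_in a_sym a_irr vs; rewrite sz degs.
rewrite /cubic_check; set s := edge_list _ _ => /and4P[/eqP s12 Us s_lt chk].
pose f := nth v0 (v0 :: vs).
have sa p : p \in s -> a (f p.1) (f p.2).
  move=> ps; apply: (@edge_list_adj _ a (v0 :: vs) (f p.1, f p.2)).
  have -> : edge_list (v0 :: vs) (adj_rows a (v0 :: vs)) = [seq (f p.1, f p.2) | p <- s].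
    rewrite -edge_list_map; congr edge_list.
    by rewrite -[LHS](mkseq_nth v0) /mkseq /= sz.
  exact: (map_f (fun p => (f p.1, f p.2))).
have f_inj (i j : 'I_8) : f i = f j -> i = j.
  move=> /eqP; rewrite nth_uniq //= ?sz ?ltn_ord // => /eqP; exact: val_inj.
have isoL : isomorphic (list_graph s) K.
  have [||||e|bf [g bg E]] := @simple_graph_iso (list_graph s) K (fun i : 'I_8 => f i).
  - exact: list_graph_ends_inj.
  - exact: f_inj.
  - by rewrite K8 card_ord.
  - by rewrite K12 card_ord.
  - have [_ se te] := list_graph_val s_lt e.
    have /sa/adjP[e' _ /eqP E'] := mem_nth (0, 0)%N (ltn_ord e).
    by exists e'; rewrite E' -se -te /ends imsetU1 imset_set1.
  by exists (fun i : 'I_8 => f i), g.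
have cd j : nb_deletions K j = count_deletions s j.
  by rewrite -(isomorphic_nb_deletions j isoL) nb_deletions_list_graph.
rewrite !cd; move: chk; case: ifP => [lt _|_]; first exact: Or31.
case: ifP => [/hasP[o _ /and4P[/eqP o8 Uo o_lt ow]] _|_ /andP[/eqP c3 c4]]; last exact: Or32.
apply: Or33.
have o_ltn i : (i < 8)%N -> (nth 0%N o i < 8)%N.
  by move=> i8; apply: (allP o_lt); rewrite mem_nth // o8.
pose F (i : 'I_8) := f (nth 0%N o i).
have F_inj : injective F.
  move=> i j; rewrite /F.
  move=> /(f_inj (Ordinal (o_ltn _ (ltn_ord i))) (Ordinal (o_ltn _ (ltn_ord j))))/(congr1 val) /= /eqP.
  by rewrite nth_uniq ?o8 ?ltn_ord // => /eqP/val_inj.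
have [||||e|bf [g bg E]] := @simple_graph_iso wagner K F.
- exact: wagner_ends_inj.
- exact: F_inj.
- by rewrite K8; have [] := wagner_card.
- by rewrite K12; have [] := wagner_card.
- have /orP[] /= := allP ow _ (wagner_edge_mem e) => /sa/adjP[e' _ /eqP E'].
    by exists e'; rewrite E' /ends imsetU1 imset_set1.
  by exists e'; rewrite E' /ends imsetU1 imset_set1 setUC.
by exists F, g.
Qed.

(* Polynomials are lists of coefficients, constant coefficient first. *)
Fixpoint npoly_add (s t : seq nat) : seq nat :=
  match s, t with
  | [::], _ => t
  | _, [::] => s
  | x :: s', y :: t' => (x + y)%N :: npoly_add s' t'
  end.

(** Multiplication by the linear polynomial X + c, the length of a chain when X stands for q - 1. *)
Definition npoly_scale (c : nat) (s : seq nat) : seq nat :=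
  npoly_add [seq (c * x)%N | x <- s] (0%N :: s).

Definition npoly_eval (r : nat) (s : seq nat) : nat :=
  foldr (fun x y => x + r * y)%N 0%N s.

Lemma npoly_eval_add r s t :
  npoly_eval r (npoly_add s t) = (npoly_eval r s + npoly_eval r t)%N.
Proof.
elim: s t => [|x s IHs] [|y t] //=; first by rewrite addn0.
by rewrite IHs mulnDr addnACA.
Qed.

Lemma npoly_eval_scale r c s :
  npoly_eval r (npoly_scale c s) = ((r + c) * npoly_eval r s)%N.
Proof.
rewrite npoly_eval_add /= add0n mulnDl addnC; congr addn.
by elim: s => [|x s IHs] /=; rewrite ?muln0 // IHs mulnDr mulnCA.
Qed.

(** * Deletion counts of the Wagner graph and its imbalanced subdivision *)

Section WagnerLabels.
Variables (A : Type) (c : nat -> A).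

(** Rim edges are numbered 0 to 7 and spokes 8 to 11; edges 0 and 8 meet at vertex 0. *)
Definition wagner_weight (e : edge wagner) : A :=
  match e with inl i => c i | inr j => c (8 + j)%N end.

Definition wagner_list : seq (nat * nat * A) :=
  [seq (k, (k.+1 %% 8)%N, c k) | k <- iota 0 8] ++
  [seq (k, (4 + k)%N, c (8 + k)%N) | k <- iota 0 4].

Definition wagner_enum : seq (edge wagner) :=
  [seq inl i | i <- enum 'I_8] ++ [seq inr j | j <- enum 'I_4].

Lemma wagner_enum_uniq : uniq wagner_enum.
Proof.
rewrite cat_uniq; apply/and3P; split.
- by rewrite map_inj_uniq ?enum_uniq // => i j [].
- by apply/hasPn => e /mapP[j _ ->]; apply/negP => /mapP[].
- by rewrite map_inj_uniq ?enum_uniq // => i j [].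
Qed.

Lemma mem_wagner_enum e : e \in wagner_enum.
Proof.
by case: e => i; rewrite mem_cat; apply/orP; [left|right]; rewrite map_f // mem_enum.
Qed.

Lemma wagner_list_enum :
  [seq (val (src e), val (tgt e), wagner_weight e) | e : edge wagner <- wagner_enum] =
  wagner_list.
Proof.
rewrite map_cat; congr cat; rewrite -[LHS]map_comp.
  by rewrite -(val_enum_ord 8) -[RHS]map_comp.
by rewrite -(val_enum_ord 4) -[RHS]map_comp.
Qed.

End WagnerLabels.

Lemma nb_deletions_wagner j : nb_deletions wagner j = count_deletions wagner_edges j.
Proof.
rewrite nb_deletions_weighted.
have := @weighted_deletions_sum unit nat 0%N 1%N addn (fun _ c => c) id (fun _ => 1%N)
  erefl erefl (fun _ _ => erefl) (fun _ t => esym (mul1n t)) wagner 8 id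
  (wagner_weight (fun _ => tt)) (Bijective (fun _ => erefl) (fun _ => erefl))
  wagner_enum j isT wagner_enum_uniq mem_wagner_enum.
by rewrite wagner_list_enum.
Qed.

Lemma wagner_connected : connected wagner.
Proof.
have : (connected wagner : nat) = 1%N.
  by rewrite -(weighted_deletions0 (fun _ => 1%N)) -nb_deletions_weighted nb_deletions_wagner.
by case: (connected wagner).
Qed.

(* One spoke is lengthened and one rim edge at its end is shortened: spokes    *)
(* lie in 168, rim edges only in 161 of the complements of spanning trees.     *)
Definition imbalanced_length (q : nat) : edge wagner -> nat :=
  wagner_weight (fun k => q.-1 + (if k == 0 then 0 else if k == 8 then 2 else 1))%N.

Lemma imbalanced_length_gt0 q e : (1 < q)%N -> (0 < imbalanced_length q e)%N.
Proof. by move=> q1; case: e => i; rewrite /imbalanced_length /= addn_gt0 -subn1 subn_gt0 q1. Qed.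

Lemma imbalanced_length_not_balanced q : (1 < q)%N -> ~ balanced (imbalanced_length q).
Proof.
move=> q1 /(_ (inr ord0) (inl ord0)); rewrite /imbalanced_length /=.
by rewrite addn0 addn2 ltnn.
Qed.

Lemma imbalanced_length_sum q : (0 < q)%N ->
  \sum_e imbalanced_length q e = (12 * q)%N.
Proof.
move=> q0; rewrite big_sumType /= !big_ord_recr !big_ord0 /=; lia.
Qed.

(** The weighted count is a polynomial in [r] = q - 1, computed once for all q on coefficient lists.
    In terms of q it is 392 q^5 + 7 q^4 - 51 q^3, and 7 q > 51 from q = 8 on. *)
Lemma imbalanced_more_deletions q : (8 <= q)%N ->
  (nb_deletions wagner 5 * q ^ 5 < weighted_deletions (imbalanced_length q) 5)%N.
Proof.
case: q => // r r7; rewrite nb_deletions_wagner.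
pose c k : nat := if k == 0%N then 0%N else if k == 8 then 2%N else 1%N.
have -> : weighted_deletions (imbalanced_length r.+1) 5 =
    weighted_deletions ((fun x : nat => (r + x)%N) \o wagner_weight c) 5.
  congr weighted_deletions; apply/funext => -[i|i] /=; rewrite /imbalanced_length /= /c;
  by do 2?case: ifP.
rewrite (@weighted_deletions_sum nat (seq nat) [::] [:: 1%N] npoly_add npoly_scale
  (npoly_eval r) (fun x : nat => (r + x)%N) erefl _ (npoly_eval_add r) (npoly_eval_scale r)
  wagner 8 id _ (Bijective (fun _ => erefl) (fun _ => erefl))
  wagner_enum 5 isT wagner_enum_uniq mem_wagner_enum); last by rewrite /= muln0.
rewrite wagner_list_enum.
have -> : deletion_sum [::] [:: 1%N] npoly_add npoly_scale (wagner_list c) 5 (iota 0 8) =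
  [:: 348; 1835; 3809; 3897; 1967; 392]%N by vm_compute.
have -> : count_deletions wagner_edges 5 = 392 by vm_compute.
rewrite /npoly_eval /=.
(* Adding 51 q^3 to both sides avoids subtraction in the natural numbers. *)
rewrite -(ltn_add2r (51 * r.+1 ^ 3)).
have -> : (348 + r * (1835 + r * (3809 + r * (3897 + r * (1967 + r * (392 + r * 0))))) +
    51 * r.+1 ^ 3 = 392 * r.+1 ^ 5 + 7 * r.+1 * r.+1 ^ 3)%N by ring.
by rewrite ltn_add2l ltn_pmul2r ?expn_gt0 //; lia.
Qed.

(** * Comparison with the balanced subdivision *)

Lemma nb_deletions_eq0 G j :
  (#|edge G|.+1 < #|vert G| + j)%N -> nb_deletions G j = 0%N.
Proof.
move=> le; apply/eqP; rewrite cards_eq0; apply/eqP/setP => X; rewrite !inE.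
apply/negP => /andP[/eqP Xj /connected_card cX].
by have := cardsC X; rewrite Xj; lia.
Qed.

Lemma subdivide_wagner_class (l : edge wagner -> nat) q : (0 < q)%N ->
  (forall e, 0 < l e)%N -> \sum_e l e = (12 * q)%N ->
  graph_class (12 * q - 4) (12 * q) (subdivide l).
Proof.
move=> q0 l0 sl; have [w8 w12] := wagner_card.
split; first exact: subdivide_class wagner_connected.
- by have := card_subdivide_vert l0; rewrite w8 w12 sl; lia.
- by rewrite card_subdivide_edge.
Qed.

Section BalancedWagner.
Variable q : nat.
Hypothesis q0 : (0 < q)%N.

Lemma balanced_wagner_class : graph_class (12 * q - 4) (12 * q) (balanced_wagner q).
Proof.
have [_ w12] := wagner_card.
by apply: subdivide_wagner_class => //; rewrite sum_nat_const w12.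
Qed.

Lemma nb_deletions_balanced_wagner j :
  nb_deletions (balanced_wagner q) j = (count_deletions wagner_edges j * q ^ j)%N.
Proof.
by rewrite nb_deletions_subdivide // weighted_deletions_cst nb_deletions_wagner.
Qed.

(** Each of c_1 to c_4 is either smaller for [H], which ends the comparison, or equal, which gives
    the structure needed for the next one. *)
Lemma wagner_optimal_counts H : graph_class (12 * q - 4) (12 * q) H ->
  isomorphic H (balanced_wagner q) \/
  exists k, [/\ (k <= 4)%N,
    forall j, (j < k)%N -> nb_deletions (balanced_wagner q) j = nb_deletions H j
    & (nb_deletions H k < nb_deletions (balanced_wagner q) k)%N].
Proof.
move=> [cH vH eH].
have c0 : count_deletions wagner_edges 0 = 1 by [].
have c1 : count_deletions wagner_edges 1 = 12 by vm_compute.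
have c2 : count_deletions wagner_edges 2 = 66 by vm_compute.
have c3 : count_deletions wagner_edges 3 = 212 by vm_compute.
have c4 : count_deletions wagner_edges 4 = 409 by vm_compute.
have B0 : nb_deletions (balanced_wagner q) 0 = nb_deletions H 0.
  by rewrite nb_deletions_balanced_wagner c0 nb_deletions_weighted weighted_deletions0 cH.
have B1 : nb_deletions (balanced_wagner q) 1 = (12 * q)%N.
  by rewrite nb_deletions_balanced_wagner c1 expn1.
have B2 : nb_deletions (balanced_wagner q) 2 = (66 * q ^ 2)%N.
  by rewrite nb_deletions_balanced_wagner c2.
have : (nb_deletions H 1 <= 12 * q)%N by apply: nb_deletions1_le.
rewrite leq_eqVlt => /predU1P[H1|H1]; last first.
  right; exists 1%N; split=> [//|[_|j]|]; [exact: B0|by []|by rewrite B1].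
have [] := nb_deletions2_extremal q0 cH vH eH H1.
rewrite leq_eqVlt => /predU1P[H2|H2] ex; last first.
  right; exists 2; split=> [//|[_|[_|j]]|]; [exact: B0| |by []|by rewrite B2].
  by rewrite B1 H1.
have [K D cubicK] := ex H2.
have HK j : nb_deletions H j = (nb_deletions K j * q ^ j)%N.
  rewrite (isomorphic_nb_deletions j (chain_decomposition_isomorphic D)).
  by rewrite (nb_deletions_subdivide (fun _ => q0)) weighted_deletions_cst.
have [K3|[K3 K4]|[f [g [bf bg E]]]] := cubic_classification cubicK; last first.
- by left; apply: chain_decomposition_isomorphic; apply: (chain_decomposition_iso bf bg E D).
- right; exists 4; split=> [//|[_|[_|[_|[_|j]]]]|]; [exact: B0| | | |by []|].
  + by rewrite B1 H1.
  + by rewrite B2 H2.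
  + by rewrite nb_deletions_balanced_wagner c3 HK K3.
  + by rewrite nb_deletions_balanced_wagner c4 HK ltn_pmul2r ?expn_gt0 ?q0 ?K4.
- right; exists 3; split=> [//|[_|[_|[_|j]]]|]; [exact: B0| | |by []|].
  + by rewrite B1 H1.
  + by rewrite B2 H2.
  + by rewrite nb_deletions_balanced_wagner c3 HK ltn_pmul2r ?expn_gt0 ?q0 ?K3.
Qed.

End BalancedWagner.

(** * From deletion counts to reliability *)

Section ReliabilityComparison.
Local Open Scope ring_scope.
Variable R : realType.

Lemma isomorphic_reliability G H (p : R) :
  isomorphic G H -> reliability G p = reliability H p.
Proof.
move=> I; have [_ E] := isomorphic_card I; rewrite !reliabilityE E.
by apply: eq_bigr => j _; rewrite (isomorphic_nb_deletions j I).
Qed.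

Lemma balanced_wagner_more_reliable q H (p : R) : (0 < q)%N ->
  graph_class (12 * q - 4) (12 * q) H -> 1 - 4^-1 ^+ (12 * q).+1 < p < 1 ->
  isomorphic H (balanced_wagner q) \/ reliability H p < reliability (balanced_wagner q) p.
Proof.
move=> q0 HC pb; have [|[k [k4 eqk ltk]]] := wagner_optimal_counts q0 HC; first by left.
right; have [_ _ eH] := HC; have [_ _ eG] := balanced_wagner_class q0.
rewrite !reliabilityE eH eG; apply: bernstein_lt_near1 ltk _ pb => //.
  by apply: leq_trans k4 _; lia.
by rewrite -eH sum_nb_deletions.
Qed.

(** Deleting more than m + 1 - n edges always disconnects, so the number of spanning trees is the
    last coefficient that can differ. *)
Lemma more_spanning_trees_more_reliable n m G H (p : R) : (n <= m.+1)%N ->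
  graph_class n m G -> graph_class n m H ->
  (nb_spanning_trees G < nb_spanning_trees H)%N -> 0 < p < 4^-1 ^+ m.+1 ->
  reliability G p < reliability H p.
Proof.
move=> nm [/andP[n0 _] vG eG] [_ vH eH]; rewrite vG in n0; pose k := (m.+1 - n)%N.
have kE : m.+1 = (n + k)%N by rewrite subnKC.
rewrite (@nb_spanning_treesE G k) ?vG ?eG // (@nb_spanning_treesE H k) ?vH ?eH // => lt pb.
rewrite !reliabilityE eG eH; apply: bernstein_lt_near0 lt _ pb => //.
- by lia.
- by move=> j kj jm; rewrite !nb_deletions_eq0 // ?vG ?vH ?eG ?eH kE ltn_add2l.
- by rewrite -eG sum_nb_deletions.
Qed.

End ReliabilityComparison.

Local Open Scope ring_scope.

Theorem theorem10p2 (R : realType) (q : nat) (hq : (1 <= q)%N) :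
  (exists2 p0 : R, 0 < p0 < 1 &
     forall p : R, p0 < p < 1 ->
       p_optimal (12 * q - 4) (12 * q) p (balanced_wagner q) /\
       (forall H : mgraph, p_optimal (12 * q - 4) (12 * q) p H ->
          isomorphic H (balanced_wagner q)))
  /\
  ((8 <= q)%N ->
     (exists H : mgraph,
        [/\ graph_class (12 * q - 4) (12 * q) H,
            imbalanced_subdivision wagner H,
            (nb_spanning_trees (balanced_wagner q) < nb_spanning_trees H)%N
          & exists2 p1 : R, 0 < p1 < 1 &
              forall p : R, 0 < p < p1 ->
                strictly_more_reliable p H (balanced_wagner q)])
     /\
     ~ (exists K : mgraph, uniquely_optimal R (12 * q - 4) (12 * q) K)).
Proof.
set n := (12 * q - 4)%N; set m := (12 * q)%N.
pose d : R := 4^-1 ^+ m.+1.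
have d0 : 0 < d by rewrite exprn_gt0 // invr_gt0.
have d1 : d < 1 by rewrite exprn_ilt1 //; lra.
have GC := balanced_wagner_class hq.
have near1 H (p : R) : graph_class n m H -> 1 - d < p < 1 ->
    isomorphic H (balanced_wagner q) \/ reliability H p < reliability (balanced_wagner q) p.
  exact: balanced_wagner_more_reliable.
split.
  exists (1 - d) => [|p pb]; first by apply/andP; split; lra.
  split=> [|H [HC opt]].
    split=> // H HC; have [I|/ltW//] := near1 H p HC pb.
    by rewrite (isomorphic_reliability p I).
  by have [//|lt] := near1 H p HC pb; move: lt; rewrite ltNge opt.
move=> q8; have q1 : (1 < q)%N by lia.
pose l := imbalanced_length q; pose H := subdivide l.
have l0 e : (0 < l e)%N by apply: imbalanced_length_gt0.
have HC : graph_class n m H.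
  exact: subdivide_wagner_class (imbalanced_length_sum hq).
have nm : (m.+1 = n + 5)%N by rewrite /m /n; lia.
have trees : (nb_spanning_trees (balanced_wagner q) < nb_spanning_trees H)%N.
  have [_ vG eG] := GC; have [_ vH eH] := HC.
  rewrite (@nb_spanning_treesE _ 5) ?vG ?eG // (@nb_spanning_treesE H 5) ?vH ?eH //.
  rewrite (nb_deletions_subdivide l0) (nb_deletions_subdivide (fun _ => hq)).
  by rewrite weighted_deletions_cst; apply: imbalanced_more_deletions.
have near0 (p : R) : 0 < p < d -> reliability (balanced_wagner q) p < reliability H p.
  by apply: more_spanning_trees_more_reliable GC HC trees; rewrite nm leq_addr.
split.
  exists H; split=> //; last by exists d; rewrite ?d0.
  exists l; split=> //; first exact: imbalanced_length_not_balanced.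
  exact: isomorphic_refl.
move=> [K [KC best]].
(* The point 1 - d/2 lies in the range of [near1] and identifies [K] with the balanced subdivision;
   the point d/2 lies in that of [near0], where [H] beats it. *)
have dh : 0 < d / 2 < d by apply/andP; split; lra.
have IK : isomorphic K (balanced_wagner q).
  have dh1 : 1 - d < 1 - d / 2 < 1 by apply/andP; split; lra.
  have [//|lt] := near1 K _ KC dh1.
  have [//|nI] := pselect (isomorphic K (balanced_wagner q)).
  have : reliability (balanced_wagner q) (1 - d / 2) < reliability K (1 - d / 2).
    by apply: best => //; [apply/andP; split; lra | move/isomorphic_sym].
  by rewrite ltNge (ltW lt).
have := near0 _ dh; rewrite -(isomorphic_reliability _ IK) => lt.
have : reliability H (d / 2) < reliability K (d / 2).
  apply: best => //; first by apply/andP; split; lra.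
  by move=> I; move: lt; rewrite (isomorphic_reliability _ I) ltxx.
by rewrite ltNge (ltW lt).
Qed.
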